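(* Let $\varepsilon\in(0,1)$, $\beta=\beta(\varepsilon)\in(0,1)$, let $u_0^\varepsilon\in H^1(0,1)$ be the measured data, and let $\mathbf{P}_\varepsilon^\beta:H^1(0,1)\to L^2(0,1)$ be a stabilized operator. Let $u_\beta^{\varepsilon,0}=0$ and, for $k\ge1$, let $u_\beta^{\varepsilon,k}$ be the weak solution of $$\partial_x^2u_\beta^{\varepsilon,k}-\partial_y^2u_\beta^{\varepsilon,k}=-\mathbf{P}_\varepsilon^\beta u_\beta^{\varepsilon,k-1},\quad u_\beta^{\varepsilon,k}(x,0)=u_\beta^{\varepsilon,k}(x,1)=0,\quad u_\beta^{\varepsilon,k}(0,y)=u_0^\varepsilon(y),\ \partial_xu_\beta^{\varepsilon,k}(0,y)=0.$$ Then, for a suitable choice of $\bar x=\bar x_\beta>0$ with $[0,\bar x]\subset[0,1]$, made in terms of $\gamma(\beta)$, the approximate solution $u_\beta^{\varepsilon,k}$ is strongly convergent in $\mathbb{H}_{\bar x}$ as $k\to\infty$. Furthermore, for each $\varepsilon$ one can find a sufficiently small $\eta_\beta\in(0,1)$ such that $$\|u_\beta^{\varepsilon,k}-u_\beta^\varepsilon\|_{\mathbb{H}_{\bar x}}\le\frac{\eta_\beta^k}{1-\eta_\beta}\,\|u_\beta^{\varepsilon,1}\|_{\mathbb{H}_{\bar x}}$$ for the iterates $u_\beta^{\varepsilon,k}$, where $u_\beta^\varepsilon$ is the weak solution of the regularized problem $$\partial_x^2u_\beta^\varepsilon-\partial_y^2u_\beta^\varepsilon+\mathbf{P}_\varepsilon^\beta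 u_\beta^\varepsilon=0,\quad u_\beta^\varepsilon(x,0)=u_\beta^\varepsilon(x,1)=0,\quad u_\beta^\varepsilon(0,y)=u_0^\varepsilon(y),\ \partial_xu_\beta^\varepsilon(0,y)=0.$$
   Context: All functions are real-valued. $\|\cdot\|$ is the norm of $L^2(0,1)$ (in the variable $y$), and $\langle\cdot,\cdot\rangle$ is the $L^2(0,1)$ inner product or the duality pairing between $H^{-1}(0,1)$ and $H_0^1(0,1)$. Functions of $(x,y)$ are viewed as functions of $x$ with values in function spaces in $y\in(0,1)$; $\mathbf{P}_\varepsilon^\beta$ acts in the variable $y$. The equations are posed for $(x,y)\in(0,1)\times(0,1)$, the boundary conditions for $x\in[0,1]$ and the initial conditions for $y\in[0,1]$. Measured data: $u_0^\varepsilon\in H^1(0,1)$ with $\|u_0^\varepsilon-u_0\|_{H^1(0,1)}\le\varepsilon$, where $u_0\in H^1(0,1)$ is the exact datum and $\varepsilon$ the noise level. Auxiliary function: $\gamma:(0,1)\to\mathbb{R}$ with $\gamma(\beta)\ge1$ for all $\beta\in(0,1)$ and $\lim_{\beta\to0}\gamma(\beta)=\infty$. The regularization parameter $\beta(\varepsilon)\in(0,1)$ satisfies $\beta\to0$ as $\varepsilon\to0$. Stabilized operator: a linear map $\mathbf{P}_\varepsilon^\beta:H^1(0,1)\to L^2(0,1)$ for which there is a constant $C_1>0$ independent of $\varepsilon$ with $\|\mathbf{P}_\varepsilon^\beta u\|\le C_1\log(\gamma(\beta))\|u\|_{H^1(0,1)}$ for all $u\in H^1(0,1)$. Weak solution of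 $\partial_x^2v-\partial_y^2v=g$ with zero Dirichlet conditions at $y=0,1$ and initial data $v(0)=u_0^\varepsilon$, $\partial_xv(0)=0$ (here $g=-\mathbf{P}_\varepsilon^\beta u_\beta^{\varepsilon,k-1}$ for the iterates and $g=-\mathbf{P}_\varepsilon^\beta v$ for $v=u_\beta^\varepsilon$): $v\in C([0,1];H_0^1(0,1))$, $\partial_xv\in C([0,1];L^2(0,1))$, $\partial_x^2v\in L^2(0,1;H^{-1}(0,1))$; for every $\psi\in H_0^1(0,1)$, $\langle\partial_x^2v,\psi\rangle+\langle\partial_yv,\partial_y\psi\rangle=\langle g,\psi\rangle$ for a.e. $x\in(0,1)$; $v(0)=u_0^\varepsilon$, $\partial_xv(0)=0$. These weak solutions are taken to exist and be unique. Space: $\mathbb{H}_{\bar x}=\{u\in C([0,\bar x];H^1(0,1)):\ u_x\in C([0,\bar x];L^2(0,1))\}$, with its natural norm built from $\|u\|_{C([0,\bar x];H^1(0,1))}$ and $\|u_x\|_{C([0,\bar x];L^2(0,1))}$ (for instance their sum). *)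

(* Defs.v *)
From mathcomp Require Import all_boot all_order all_algebra.
From mathcomp Require Import all_classical all_reals all_analysis.

Set Implicit Arguments.
Unset Strict Implicit.
Unset Printing Implicit Defensive.

Import Order.TTheory GRing.Theory Num.Theory.
Import numFieldNormedType.Exports.

Local Open Scope classical_set_scope.
Local Open Scope ring_scope.

(* Elements of L^2(0,1) and H^1(0,1) are represented by measurable functions
   R -> R (extended arbitrarily outside of ]0, 1[), identified when they agree
   almost everywhere on ]0, 1[.  A map x |-> u(x, .) is represented by u : R -> R -> R. *)
Section Defs.
Context {R : realType}.
Implicit Types (f g u v phi psi : R -> R) (x y T : R).

Definition mu01 : {measure set (measurableTypeR R) -> \bar R} :=
  mrestr (@lebesgue_measure R) (measurable_itv `]0, 1[%R).

(* L2norm, H1norm and HHnorm take junk values outside of L2, H1 and HH, hence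
   the explicit membership conditions below. *)
Definition L2 : set (R -> R) := [set f | f \in Lfun mu01 2%:E].
Definition L2norm f : R := fine ('N[mu01]_2%:E[EFin \o f]).
Definition L2ip f g : R := \int[mu01]_y (f y * g y).

(* C_c^oo(0,1) *)
Definition test_fun phi : Prop :=
  (forall n x, derivable (derive1n n phi) x 1) /\
  exists a b : R, [/\ 0 < a, b < 1 & forall y, y \notin `[a, b] -> phi y = 0].

Definition is_wderiv u g : Prop :=
  L2 g /\
  forall phi, test_fun phi -> L2ip u (derive1 phi) = - L2ip g phi.

Definition wderiv u : R -> R := xget (cst 0) [set g | is_wderiv u g].

Definition H1 : set (R -> R) := [set u | L2 u /\ exists g, is_wderiv u g].
Definition H1norm u : R :=
  Num.sqrt (L2norm u ^+ 2 + L2norm (wderiv u) ^+ 2).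

(* H_0^1(0,1): the closure of C_c^oo(0,1) in H^1(0,1) *)
Definition H10 : set (R -> R) := [set u | H1 u /\
  forall e : R, 0 < e ->
    exists phi, test_fun phi /\ H1norm (fun y => u y - phi y) < e].

(* H^{-1}(0,1): the bounded linear functionals on H_0^1(0,1); F psi is the
   duality pairing <F, psi>. *)
Definition Hm1 (F : (R -> R) -> R) : Prop :=
  (forall (a : R) psi phi, H10 psi -> H10 phi ->
     F (fun y => a * psi y + phi y) = a * F psi + F phi) /\
  exists M : R, forall psi, H10 psi -> `|F psi| <= M * H1norm psi.

Definition Hm1norm (F : (R -> R) -> R) : \bar R :=
  ereal_sup [set `|F psi|%:E | psi in [set psi | H10 psi /\ H1norm psi <= 1]].

(* C([0,T]; X) for a space X normed by N *)
Definition contin (X : set (R -> R)) (N : (R -> R) -> R) T (u : R -> R -> R)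
    : Prop :=
  (forall x, x \in `[0, T] -> X (u x)) /\
  (forall x, x \in `[0, T] ->
     N (fun y => u s y - u x y) @[s --> within `[0, T] (nbhs x)] --> 0).

(* u' = du/dx on [0,T] as a limit of difference quotients in L^2(0,1),
   one-sided at the end points; for a continuous u' this is the same as the
   distributional derivative. *)
Definition is_dx T (u u' : R -> R -> R) : Prop :=
  (forall x, x \in `[0, T] -> L2 (u x) /\ L2 (u' x)) /\
  (forall x, x \in `[0, T] ->
     L2norm (fun y => (u s y - u x y) / (s - x) - u' x y)
       @[s --> within `[0, T] x^'] --> 0).

Definition dx T (u : R -> R -> R) : R -> R -> R :=
  xget (fun _ _ => 0) [set u' | is_dx T u u'].

(* L^2(0,1; H^{-1}(0,1)).  As H^{-1} is separable and reflexive, weak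
   measurability is the same as strong measurability. *)
Definition L2Hm1 (z : R -> (R -> R) -> R) : Prop :=
  [/\ forall x, x \in `]0, 1[ -> Hm1 (z x),
      forall psi, H10 psi ->
        measurable_fun (`]0, 1[ : set (measurableTypeR R)) (fun x => z x psi)
    & (\int[mu01]_x (Hm1norm (z x) ^+ 2) < +oo)%E].

(* z is the distributional derivative dw/dx on ]0,1[ of w, whose values in
   L^2(0,1) are seen as elements of H^{-1}(0,1). *)
Definition is_dx_Hm1 (w : R -> R -> R) (z : R -> (R -> R) -> R) : Prop :=
  forall theta psi, test_fun theta -> H10 psi ->
    \int[mu01]_x (L2ip (w x) psi * derive1 theta x)
    = - \int[mu01]_x (z x psi * theta x).

Definition weak_solution (u0 : R -> R) (g v : R -> R -> R) : Prop :=
  exists (w : R -> R -> R) (z : R -> (R -> R) -> R),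
    [/\ contin H10 H1norm 1 v,
        is_dx 1 v w /\ contin L2 L2norm 1 w,
        L2Hm1 z /\ is_dx_Hm1 w z,
        forall psi, H10 psi ->
          {ae mu01, forall x,
             z x psi + L2ip (wderiv (v x)) (wderiv psi) = L2ip (g x) psi}
      & v 0 = u0 %[ae mu01] /\ w 0 = cst 0 %[ae mu01] ].

(* v is the unique weak solution of the problem with source term G v; G is
   constant for a linear problem with a given source. *)
Definition the_weak_solution (u0 : R -> R)
    (G : (R -> R -> R) -> R -> R -> R) (v : R -> R -> R) : Prop :=
  weak_solution u0 (G v) v /\
  forall v' : R -> R -> R, weak_solution u0 (G v') v' ->
    forall x, x \in `[0, 1] -> v' x = v x %[ae mu01].

(* With c = gamma(beta).  Linearity and boundedness make P compatible with
   almost everywhere equality. *)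
Definition stabilized (C1 c : R) (P : (R -> R) -> R -> R) : Prop :=
  [/\ forall u, H1 u -> L2 (P u),
      forall (a : R) u v, H1 u -> H1 v ->
        P (fun y => a * u y + v y) = (fun y => a * P u y + P v y) %[ae mu01]
    & forall u, H1 u -> L2norm (P u) <= C1 * ln c * H1norm u].

(* The space H_T and its norm *)
Definition HH T : set (R -> R -> R) := [set u |
  contin H1 H1norm T u /\
  exists2 u', is_dx T u u' & contin L2 L2norm T u'].

Definition HHnorm T (u : R -> R -> R) : R :=
  sup [set H1norm (u x) | x in `[0, T]] +
  sup [set L2norm (dx T u x) | x in `[0, T]].

Definition strongly_convergent_HH T (u : nat -> R -> R -> R) : Prop :=
  (forall k, HH T (u k)) /\
  exists2 v, HH T v & HHnorm T (fun x y => u k x y - v x y) @[k --> \oo] --> 0.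

End Defs.

(* Main.v *)
(* Energy estimate and contraction.  If v solves v_xx - v_yy = g weakly, with zero
   Cauchy data and g continuous into L^2, the energy ||v_x||^2 + ||v_y||^2 satisfies
   E(b) - E(a) <= 2 (b - a) sup ||g|| sup ||v_x||, hence ||v_x||, ||v_y|| and ||v|| are
   at most 2 T sup ||g|| on [0, T].  As v_x is not an admissible test function, the
   energy inequality is obtained by testing with v(x + h) - v(x - h), and by recognizing
   in the resulting identity differences of the symmetric functions (v_x(r), v_x(s)) and
   (v_y(r), v_y(s)).  With g = - P (u - u'), the solution map contracts H_T with factor
   5 T C1 log gamma(beta), which is at most 1/2 for T = 1 / (10 C1 log gamma(beta) + 1).
   The limit of the iterates is the regularized solution itself, which is given, so that
   no completeness argument is needed; eta = 1/2 works for every beta. *)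
Require Import Defs.
From mathcomp Require Import all_boot all_order all_algebra.
From mathcomp Require Import all_classical all_reals all_analysis.
From mathcomp Require Import measurable_realfun ring lra.
Import Order.TTheory GRing.Theory Num.Theory.
Import numFieldNormedType.Exports.
Local Open Scope classical_set_scope.
Local Open Scope ring_scope.

Set Implicit Arguments.
Unset Strict Implicit.
Unset Printing Implicit Defensive.

(** * One-variable calculus and the energy balance *)

Section Calculus.
Context {R : realType}.
Implicit Types (f g : R -> R) (a b x l : R).

(** Two obstacles lie outside the energy argument. A weak solution satisfies its equation only for
    almost every x, and its second x-derivative is a distribution with values in H^{-1}. When the
    source is continuous into L^2, the derivative of x |-> <v_x(x), psi> agrees almost everywhere
    with a continuous function, and the du Bois-Reymond lemma makes it a classical derivative at
    every x of ]0, 1[; after that H^{-1} no longer occurs. Moreover elements of L^2 and H^1 are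
    plain functions, and [wderiv] and [dx] are picked by choice. Linearity of [wderiv] therefore
    holds only almost everywhere and rests on uniqueness of weak derivatives, proved by Lebesgue
    differentiation; [dx] enters the norms only through numbers that do not depend on the choice.
    The factor 5 is 3 + 2: ||v|| and ||v_y|| are at most 2 T sup ||g||, so the H^1 norm is at most
    sqrt 8 <= 3 times T sup ||g||, and ||v_x|| adds 2. The + 1 in the choice of T keeps T in ]0, 1]
    even when log gamma(beta) = 0. *)

Lemma is_derive1P f x l : is_derive x 1 f l <->
  forall e, 0 < e -> exists2 d, 0 < d & forall s, `|s - x| < d ->
    `|f s - f x - l * (s - x)| <= e * `|s - x|.
Proof.
split=> [[df dfl] e e0|H].
  move/cvg_ex : df => [l' dl']; have ll' : l' = l.
    by rewrite -dfl; apply/esym/cvg_lim.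
  move: dl'; rewrite ll' => /cvgrPdist_le/(_ _ e0).
  move=> -[d /= d0 H]; exists d => // s sxd.
  have [->|sx] := eqVneq s x; first by rewrite !subrr mulr0 subrr !normr0 mulr0.
  have /= := H (s - x); rewrite sub0r normrN subr_eq0 => /(_ sxd sx).
  rewrite /= !scaler1 subrK => Hs.
  rewrite (_ : f s - f x - _ = - ((l - (s - x)^-1 * (f s - f x)) * (s - x))).
    by rewrite normrN normrM ler_wpM2r.
  by field; rewrite subr_eq0.
have K : h^-1 *: ((f \o shift x) (h *: (1 : R)) - f x) @[h --> 0^'] --> l.
  apply/cvgrPdist_le => e e0; have [d d0 Hd] := H _ e0.
  exists d => //= h; rewrite /= sub0r normrN => hd h0.
  have := Hd (h + x); rewrite addrK => /(_ hd).
  rewrite /= => Hs.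
  rewrite (_ : h *: 1 = h); last by rewrite /GRing.scale/= mulr1.
  rewrite (_ : _ *: _ = h^-1 * (f (h + x) - f x))//.
  rewrite (_ : l - _ = - ((f (h + x) - f x - l * h) / h)); last by field.
  by rewrite normrN normrM normfV ler_pdivrMr// normr_gt0.
split; first by apply/cvg_ex; exists l.
exact/cvg_lim.
Qed.

Lemma near_is_derive (f g : R -> R) (a b x l : R) : a < x -> x < b ->
  (forall y, a < y -> y < b -> f y = g y) -> is_derive x 1 f l -> is_derive x 1 g l.
Proof.
move=> ax xb fg; apply: near_eq_is_derive.
near=> y; apply/fg.
- by near: y; exact: lt_nbhsr.
- by near: y; exact: lt_nbhsl.
Unshelve. all: by end_near. Qed.

Lemma is_derive_derive1 f x l : is_derive x 1 f l -> derive1 f x = l.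
Proof. by move=> df; rewrite derive1E; case: df. Qed.

Lemma is_derive_cvg f x l : is_derive x 1 f l -> {for x, continuous f}.
Proof. by case=> df _; apply/differentiable_continuous/derivable1_diffP. Qed.

(** The end points come in either order because the increments it serves, such as [s - x] in
    [is_derive_diag], have no known sign. *)
Lemma MVT_sym f df a b :
  (forall x, Num.min a b <= x <= Num.max a b -> is_derive x 1 f (df x)) ->
  exists2 c, Num.min a b <= c <= Num.max a b & f b - f a = df c * (b - a).
Proof.
have W a' b' : a' <= b' ->
  (forall x, a' <= x <= b' -> is_derive x 1 f (df x)) ->
  exists2 c, a' <= c <= b' & f b' - f a' = df c * (b' - a').
  move=> ab H; have [||c] := @MVT_segment _ f df _ _ ab.
  - by move=> x; rewrite in_itv/= => /andP[/ltW ? /ltW ?]; apply: H; apply/andP.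
  - apply: derivable_within_continuous => x; rewrite in_itv/= => /H.
    by case.
  by rewrite in_itv/= => ? ?; exists c.
move=> H; have [ab|/ltW ba] := leP a b.
  by move: H; rewrite min_l// max_r//; exact: W.
move: H; rewrite min_r// max_l// => /(W _ _ ba)[c cab E]; exists c => //.
by rewrite -[LHS]opprB E -mulrN opprB.
Qed.

(** Joint rather than separate continuity: the kernels are evaluated at pairs (x, x + h) whose
    coordinates move together. *)
Definition cont2 (D : set R) (f : R -> R -> R) := forall x y, D x -> D y ->
  forall e, 0 < e -> exists2 d, 0 < d & forall x' y', D x' -> D y' ->
    `|x' - x| < d -> `|y' - y| < d -> `|f x' y' - f x y| <= e.

Lemma min_max_dist (d x y z c : R) : `|x - z| < d -> `|y - z| < d ->
  Num.min x y <= c <= Num.max x y -> `|c - z| < d.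
Proof.
rewrite !ltr_norml !ltrBrDl !ltrBlDl => /andP[a1 a2] /andP[b1 b2].
by rewrite ge_min le_max => /andP[/orP[c1|c1] /orP[c2|c2]]; apply/andP; split; lra.
Qed.

Lemma min_max_oo (a b x y c : R) : a < x < b -> a < y < b ->
  Num.min x y <= c <= Num.max x y -> a < c < b.
Proof.
move=> /andP[a1 a2] /andP[b1 b2].
by rewrite ge_min le_max => /andP[/orP[c1|c1] /orP[c2|c2]]; apply/andP; split; lra.
Qed.

(** Chain rule along the line s = r + h. The increment is split at the corner (x, s + h), the mean
    value theorem handles each leg, and joint continuity of the partial derivatives controls both
    errors. *)
Lemma is_derive_diag (a b : R) (phi p q : R -> R -> R) (x h : R) :
  (forall r s, a < r < b -> a < s < b -> is_derive r 1 (phi^~ s) (p r s)) ->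
  (forall r s, a < r < b -> a < s < b -> is_derive s 1 (phi r) (q r s)) ->
  cont2 [set x | a < x < b] p -> cont2 [set x | a < x < b] q ->
  a < x < b -> a < x + h < b ->
  is_derive x 1 (fun x => phi x (x + h)) (p x (x + h) + q x (x + h)).
Proof.
move=> dp dq cp cq xab xhab; apply/is_derive1P => e e0.
have e2 : 0 < e / 2 by rewrite divr_gt0.
have [d1 d10 H1] := cp _ _ xab xhab _ e2.
have [d2 d20 H2] := cq _ _ xab xhab _ e2.
have [d3 d30 Hd3] : exists2 d3, 0 < d3 & forall s, `|s - x| < d3 -> a < s < b /\ a < s + h < b.
  exists (Num.min (Num.min (x - a) (b - x)) (Num.min (x + h - a) (b - (x + h)))).
    by rewrite !lt_min; move: xab xhab => /andP[? ?] /andP[? ?]; do !(apply/andP; split); lra.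
  move=> s; rewrite !lt_min !ltr_norml => /andP[/andP[/andP[? ?] /andP[? ?]] /andP[/andP[? ?] /andP[? ?]]].
  by split; apply/andP; split; lra.
exists (Num.min d3 (Num.min d1 d2)); first by rewrite !lt_min d10 d20 d30.
move=> s; rewrite !lt_min => /and3P[s3 s1 s2]; have [sab shab] := Hd3 _ s3.
have [|c1 c1I E1] := @MVT_sym (phi^~ (s + h)) (p^~ (s + h)) x s.
  by move=> y yI; apply: dp => //; apply: min_max_oo yI.
have [|c2 c2I E2] := @MVT_sym (phi x) (q x) (x + h) (s + h).
  by move=> y yI; apply: dq => //; apply: min_max_oo yI.
have x0 d : 0 < d -> `|x - x| < d by rewrite subrr normr0.
have sxh : s + h - (x + h) = s - x by ring.
have B1 : `|p c1 (s + h) - p x (x + h)| <= e / 2.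
  apply: H1 => //; rewrite ?sxh//; first exact: min_max_oo c1I.
  by apply: min_max_dist c1I => //; exact: x0.
have B2 : `|q x c2 - q x (x + h)| <= e / 2.
  apply: H2 => //; first exact: min_max_oo c2I.
    exact: x0.
  by apply: min_max_dist c2I; rewrite ?subrr ?normr0// sxh.
rewrite (_ : _ - _ - _ = (p c1 (s + h) - p x (x + h)) * (s - x)
                       + (q x c2 - q x (x + h)) * (s - x)); last first.
  by rewrite !mulrBl -E1; move: E2; rewrite sxh => <-; ring.
rewrite (le_trans (ler_normD _ _))// !normrM -mulrDl ler_wpM2r//.
by rewrite [leRHS]splitr lerD.
Qed.

Lemma antiderivative f a b : a < b -> {within `[a, b], continuous f} ->
  exists F : R -> R, forall x, a < x < b -> is_derive x 1 F (f x).
Proof.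
move=> ab cf.
have intf : (@lebesgue_measure R).-integrable `[a, b] (EFin \o f).
  by apply: continuous_compact_integrable => //; exact: segment_compact.
exists (fun x => \int[lebesgue_measure]_(t in `[a, x]) f t) => x /andP[ax xb].
have cfx : {for x, continuous f}.
  have := continuous_subspaceW (@subset_itv_oo_cc _ _ a b) cf.
  rewrite continuous_open_subspace; last exact: interval_open.
  by move=> H; apply: H; rewrite inE/= in_itv/= ax.
have [dF F'] := continuous_FTC1_closed xb intf ax cfx.
by rewrite -F' derive1E; apply/derivableP.
Qed.

End Calculus.

(** * Energy balance for a kernel phi(r, s) standing for <v_x(r), v(s)> *)

Section EnergyBalance.
Context {R : realType}.
Implicit Types (f g : R -> R) (a b x l : R).

Lemma is_derive_shiftr f x h l :
  is_derive (x + h) 1 f l -> is_derive x 1 (fun y => f (y + h)) l.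
Proof.
move=> /is_derive1P H; apply/is_derive1P => e /H[d d0 Hd].
by exists d => // s sx; have := Hd (s + h); rewrite opprD addrACA subrr addr0 => /(_ sx).
Qed.

(* The energy (m + n) x x is the limit as h -> 0 of
   (phi x (x + h) - phi x (x - h)) / h - (1 / h) int_(x-h)^x (m - n) s (s + h) ds,
   whose x-derivative is (G x (x + h) - G x (x - h)) / h. *)
Lemma energy_balance_step (lo hi K h a b : R) (phi m n G k : R -> R -> R) :
  (forall r s, lo < r < hi -> lo < s < hi -> is_derive s 1 (phi r) (m r s)) ->
  (forall r s, lo < r < hi -> lo < s < hi ->
     is_derive r 1 (phi^~ s) (- n r s + G r s)) ->
  (forall r s, lo < r < hi -> lo < s < hi -> is_derive s 1 (G r) (k r s)) ->
  (forall r s, lo < r < hi -> lo < s < hi -> `|k r s| <= K) ->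
  cont2 [set x | lo < x < hi] m -> cont2 [set x | lo < x < hi] n ->
  cont2 [set x | lo < x < hi] G ->
  (forall r s, m r s = m s r) -> (forall r s, n r s = n s r) ->
  0 < h -> lo + (h + h) <= a -> a <= b -> b <= hi - (h + h) ->
  let mu x := m x (x + h) - n x (x + h) in
  exists p1 p2 p3 p4, [/\ a - h <= p1 <= a + h, b - h <= p2 <= b + h,
    a - h <= p3 <= a, b - h <= p4 <= b &
    (m b p2 *+ 2 - mu p4) - (m a p1 *+ 2 - mu p3) <= 2 * (b - a) * K].
Proof.
move=> dphi2 dphi1 dG Kk cm cn cG msym nsym h0 loa ab bhi mu.
have cnG : cont2 [set x | lo < x < hi] (fun r s => - n r s + G r s).
  move=> x y xD yD e e0; have e2 : 0 < e / 2 by rewrite divr_gt0.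
  have [d1 d10 H1] := cn _ _ xD yD _ e2; have [d2 d20 H2] := cG _ _ xD yD _ e2.
  exists (Num.min d1 d2); first by rewrite lt_min d10.
  move=> x' y' x'D y'D; rewrite !lt_min => /andP[x1 x2] /andP[y1 y2].
  rewrite (_ : _ - _ = (n x y - n x' y') + (G x' y' - G x y)); last by ring.
  rewrite (le_trans (ler_normD _ _))// [leRHS]splitr lerD//; last exact: H2.
  by rewrite distrC; exact: H1.
(* The interval exceeds [a - h, b] on both sides, so that M is differentiable at x and at x - h for
   every x of [a, b]. *)
have [M dM] : exists M : R -> R, forall x, a - h - h / 2 < x < b + h / 2 -> is_derive x 1 M (mu x).
  apply: antiderivative; first lra.
  apply: continuous_in_subspaceT => x; rewrite inE/= in_itv/= => /andP[x1 x2].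
  have xD : lo < x < hi by apply/andP; split; lra.
  have xhD : lo < x + h < hi by apply/andP; split; lra.
  apply/cvgrPdist_le => r r0; have r2 : 0 < r / 2 by rewrite divr_gt0.
  have [t1 t10 T1] := cm _ _ xD xhD _ r2; have [t2 t20 T2] := cn _ _ xD xhD _ r2.
  near=> y.
  have yx : `|y - x| < Num.min (Num.min t1 t2) (h / 2).
    by rewrite distrC; near: y; apply: cvgr_dist_lt; rewrite // !lt_min t10 t20 divr_gt0.
  move: yx; rewrite !lt_min => /andP[/andP[yt1 yt2]].
  rewrite ltr_norml => /andP[y1 y2].
  have yD : lo < y < hi by apply/andP; split; lra.
  have yhD : lo < y + h < hi by apply/andP; split; lra.
  have E : y + h - (x + h) = y - x by ring.
  rewrite distrC /mu (_ : _ - _ = (m y (y + h) - m x (x + h)) - (n y (y + h) - n x (x + h))); last by ring.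
  rewrite (le_trans (ler_normB _ _))// [leRHS]splitr lerD//.
    by apply: T1; rewrite ?E.
  by apply: T2; rewrite ?E.
pose Z x := phi x (x + h) - phi x (x + - h) - (M x - M (x + - h)).
(* Along s = r + h the derivative of phi contributes [mu x]; along s = r - h it contributes, by the
   symmetry of m and n, [mu (x - h)]. The derivative of [M x - M (x - h)] cancels their difference,
   and only G survives. *)
have dZ x : Num.min a b <= x <= Num.max a b ->
    is_derive x 1 Z (G x (x + h) - G x (x - h)).
  rewrite min_l// max_r// => /andP[ax xb].
  have xD : lo < x < hi by apply/andP; split; lra.
  have xhD : lo < x + h < hi by apply/andP; split; lra.
  have xhD' : lo < x + - h < hi by apply/andP; split; lra.
  have D1 := is_derive_diag dphi1 dphi2 cnG cm xD xhD.
  have D2 := is_derive_diag dphi1 dphi2 cnG cm xD xhD'.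
  have D3 : is_derive x 1 M (mu x) by apply: dM; apply/andP; split; lra.
  have D4 : is_derive x 1 (fun y => M (y + - h)) (mu (x - h)).
    by apply: is_derive_shiftr; apply: dM; apply/andP; split; lra.
  have D5 := is_deriveB (is_deriveB D1 D2) (is_deriveB D3 D4).
  apply: is_derive_eq D5 _.
  by rewrite /mu subrK (msym x (x - h)) (nsym x (x - h)); ring.
(* By the mean value theorem the difference of phi is 2 h times a value of m near the diagonal, and
   that of M is h times a value of m - n. Dividing by h leaves 2 m - (m - n) = m + n, the energy, in
   the limit. *)
have PsiE x : a <= x <= b -> exists2 xi, x - h <= xi <= x + h &
    phi x (x + h) - phi x (x + - h) = m x xi * (h + h).
  move=> /andP[ax xb].
  have [|xi] := @MVT_sym _ (phi x) (m x) (x + - h) (x + h).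
    move=> y; rewrite min_l ?max_r; [|lra|lra] => /andP[? ?].
    by apply: dphi2; apply/andP; split; lra.
  rewrite min_l ?max_r; [|lra|lra] => xiI E; exists xi => //.
  by rewrite E; congr (_ * _); ring.
have ME x : a <= x <= b -> exists2 xi, x - h <= xi <= x &
    M x - M (x + - h) = mu xi * h.
  move=> /andP[ax xb].
  have [|xi] := @MVT_sym _ M mu (x + - h) x.
    move=> y; rewrite min_l ?max_r; [|lra|lra] => /andP[? ?].
    by apply: dM; apply/andP; split; lra.
  rewrite min_l ?max_r; [|lra|lra] => xiI E; exists xi => //.
  by rewrite E; congr (_ * _); ring.
have [c] := MVT_sym dZ; rewrite min_l// max_r// => /andP[ac cb] ZE.
have GK : G c (c + h) - G c (c - h) <= K * (h + h).
  have [|xi] := @MVT_sym _ (G c) (k c) (c - h) (c + h).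
    move=> y; rewrite min_l ?max_r; [|lra|lra] => /andP[? ?].
    by apply: dG; apply/andP; split; lra.
  rewrite min_l ?max_r; [|lra|lra] => /andP[xi1 xi2] ->.
  rewrite (_ : c + h - (c - h) = h + h); last by ring.
  rewrite ler_pM2r; last lra.
  by rewrite (le_trans (ler_norm _))//; apply: Kk; apply/andP; split; lra.
have aI : a <= a <= b by rewrite lexx.
have bI : a <= b <= b by rewrite lexx andbT.
have [p1 /andP[p1l p1r] E1] := PsiE _ aI; have [p2 /andP[p2l p2r] E2] := PsiE _ bI.
have [p3 /andP[p3l p3r] E3] := ME _ aI; have [p4 /andP[p4l p4r] E4] := ME _ bI.
move: ZE; rewrite /Z E1 E2 E3 E4.
rewrite (_ : _ - _ = h * ((m b p2 *+ 2 - mu p4) - (m a p1 *+ 2 - mu p3))); last by ring.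
move=> ZE.
exists p1, p2, p3, p4; split; rewrite ?p1l ?p2l ?p3l ?p4l//.
rewrite -(ler_pM2l h0) ZE.
rewrite (_ : h * _ = (K * (h + h)) * (b - a)); last by ring.
by rewrite ler_wpM2r// subr_ge0.
Unshelve. all: by end_near. Qed.

(** In the application phi = <v_x(r), v(s)>, m = <v_x(r), v_x(s)>, n = <v_y(r), v_y(s)>, G = <g(r),
    v(s)> and k = <g(r), v_x(s)>. The derivative of phi in r is then the equation tested with v(s),
    and the conclusion is the integrated form of d/dx (||v_x||^2 + ||v_y||^2) = 2 <g, v_x>. *)
Lemma energy_balance (lo hi K : R) (phi m n G k : R -> R -> R) :
  (forall r s, lo < r < hi -> lo < s < hi -> is_derive s 1 (phi r) (m r s)) ->
  (forall r s, lo < r < hi -> lo < s < hi ->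
     is_derive r 1 (phi^~ s) (- n r s + G r s)) ->
  (forall r s, lo < r < hi -> lo < s < hi -> is_derive s 1 (G r) (k r s)) ->
  (forall r s, lo < r < hi -> lo < s < hi -> `|k r s| <= K) ->
  cont2 [set x | lo < x < hi] m -> cont2 [set x | lo < x < hi] n ->
  cont2 [set x | lo < x < hi] G ->
  (forall r s, m r s = m s r) -> (forall r s, n r s = n s r) ->
  forall a b, lo < a -> a <= b -> b < hi ->
  m b b + n b b - (m a a + n a a) <= 2 * (b - a) * K.
Proof.
move=> dphi2 dphi1 dG Kk cm cn cG msym nsym a b loa ab bhi.
apply/ler_addgt0Pr => e e0.
(* At each end point the expression 2 m - (m - n) departs from m + n by at most four errors e / 8,
   since the first m counts twice; the two end points together give e. *)
have e8 : 0 < e / 8 by rewrite divr_gt0.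
have aD : lo < a < hi by rewrite loa (le_lt_trans ab).
have bD : lo < b < hi by rewrite bhi (lt_le_trans loa).
have [d1 d10 ma] := cm _ _ aD aD _ e8; have [d2 d20 mb] := cm _ _ bD bD _ e8.
have [d3 d30 na] := cn _ _ aD aD _ e8; have [d4 d40 nb] := cn _ _ bD bD _ e8.
pose d := Num.min (Num.min (Num.min d1 d2) (Num.min d3 d4)) (Num.min (a - lo) (hi - b)).
have d0 : 0 < d by rewrite !lt_min d10 d20 d30 d40 !subr_gt0 loa.
have [[dd1 dd2 dd3 dd4] [da db]] : [/\ d <= d1, d <= d2, d <= d3 & d <= d4] /\ d <= a - lo /\ d <= hi - b.
  have : d <= d by []. 
  by rewrite {2}/d !le_min => /andP[/andP[/andP[-> ->] /andP[-> ->]] /andP[-> ->]].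
move: d d0 dd1 dd2 dd3 dd4 da db => d d0 dd1 dd2 dd3 dd4 da db.
pose h := d / 2.
have h0 : 0 < h by rewrite divr_gt0.
have dh : d = h + h by rewrite -splitr.
have loa' : lo + (h + h) <= a by rewrite -dh -lerBrDl.
have bhi' : b <= hi - (h + h) by rewrite -dh lerBrDl -lerBrDr.
have [p1 [p2 [p3 [p4 [/andP[p1l p1r] /andP[p2l p2r] /andP[p3l p3r] /andP[p4l p4r]]]]]] :=
  energy_balance_step dphi2 dphi1 dG Kk cm cn cG msym nsym h0 loa' ab bhi'.
have dist c p : c - h <= p <= c + h -> lo + (h + h) <= c <= hi - (h + h) ->
    lo < p < hi /\ `|p - c| < d.
  clear -h0 dh; rewrite dh ltr_norml => /andP[? ?] /andP[? ?].
  by split; apply/andP; split; lra.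
have distl c p : c - h <= p <= c -> lo + (h + h) <= c <= hi - (h + h) ->
    [/\ lo < p < hi, `|p - c| < d, lo < p + h < hi & `|p + h - c| < d].
  clear -h0 dh; rewrite dh !ltr_norml => /andP[? ?] /andP[? ?].
  by split; apply/andP; split; lra.
have aI : lo + (h + h) <= a <= hi - (h + h) by rewrite loa' (le_trans ab).
have bI : lo + (h + h) <= b <= hi - (h + h) by rewrite bhi' (le_trans loa').
have [||P1 P1'] := dist a p1; rewrite ?p1l//.
have [||P2 P2'] := dist b p2; rewrite ?p2l//.
have [||P3 P3' Q3 Q3'] := distl a p3; rewrite ?p3l//.
have [||P4 P4' Q4 Q4'] := distl b p4; rewrite ?p4l//.
have B1 : `|m b p2 - m b b| <= e / 8.
  by apply: mb; rewrite ?subrr ?normr0//; exact: lt_le_trans dd2.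
have B2 : `|m a p1 - m a a| <= e / 8.
  by apply: ma; rewrite ?subrr ?normr0//; exact: lt_le_trans dd1.
have B3 : `|m p4 (p4 + h) - m b b| <= e / 8.
  by apply: mb => //; exact: lt_le_trans dd2.
have B4 : `|n p4 (p4 + h) - n b b| <= e / 8.
  by apply: nb => //; exact: lt_le_trans dd4.
have B5 : `|m p3 (p3 + h) - m a a| <= e / 8.
  by apply: ma => //; exact: lt_le_trans dd1.
have B6 : `|n p3 (p3 + h) - n a a| <= e / 8.
  by apply: na => //; exact: lt_le_trans dd3.
clear -B1 B2 B3 B4 B5 B6.
move: B1 B2 B3 B4 B5 B6; rewrite !ler_norml.
move=> /andP[? ?] /andP[? ?] /andP[? ?] /andP[? ?] /andP[? ?] /andP[? ?] ?.
lra.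
Qed.

End EnergyBalance.

(** * Smooth bump functions *)

Section Smooth.
Context {R : realType}.
Implicit Types (f g : R -> R) (a b x l : R) (p q : {poly R}).

(** Bounding the order of differentiability allows induction on n with f generalized, as the product
    rule requires; [ndiff_derive1n] links it to [test_fun]. *)
Fixpoint ndiff n f : Prop :=
  if n is n'.+1 then (forall x, derivable f x 1) /\ ndiff n' (derive1 f) else True.

Lemma derive1nSr n f : derive1n n.+1 f = derive1n n (derive1 f).
Proof. by rewrite /derive1n iterSr. Qed.

Lemma ndiff_derive1n f :
  (forall n x, derivable (derive1n n f) x 1) <-> forall n, ndiff n f.
Proof.
split=> [H n|].
  elim: n f H => //= n IH f H; split; first exact: (H 0%N).
  by apply: IH => m x; rewrite -derive1nSr; exact: (H m.+1).
move=> H n; elim: n f H => [|n IH] f H x; first by case: (H 1%N).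
by rewrite derive1nSr; apply: IH => m; case: (H m.+1).
Qed.

Lemma ndiffS n f df : (forall x, is_derive x 1 f (df x)) -> ndiff n df -> ndiff n.+1 f.
Proof.
move=> fdf ndf; split=> [x|]; first by case: (fdf x).
by rewrite (_ : derive1 f = df)//; apply/funext => x; exact: is_derive_derive1.
Qed.

Lemma ndiff_is_derive n f x : ndiff n.+1 f -> is_derive x 1 f (derive1 f x).
Proof. by case=> df _; rewrite derive1E; exact/derivableP. Qed.

Lemma ndiffW n f : ndiff n.+1 f -> ndiff n f.
Proof. by elim: n f => // n IH f [df /IH]. Qed.

Lemma ndiff_lin n f g (c : R) : ndiff n f -> ndiff n g -> ndiff n (fun x => c * f x + g x).
Proof.
elim: n f g => // n IH f g nf ng.
apply: (@ndiffS _ _ (fun x => c * derive1 f x + derive1 g x)) => [x|].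
  apply: is_deriveD (is_deriveZ _ (ndiff_is_derive _ nf)) (ndiff_is_derive _ ng).
by apply: IH; [case: nf|case: ng].
Qed.

Lemma ndiff_mul n f g : ndiff n f -> ndiff n g -> ndiff n (fun x => f x * g x).
Proof.
elim: n f g => // n IH f g nf ng.
(* The factor 1 gives the derivative the shape c f + g of [ndiff_lin]. *)
apply: (@ndiffS _ _ (fun x => 1 * (f x * derive1 g x) + g x * derive1 f x)) => [x|].
  rewrite mul1r.
  exact: is_deriveM (ndiff_is_derive _ nf) (ndiff_is_derive _ ng).
apply: ndiff_lin; apply: IH.
- exact: ndiffW nf.
- by case: ng.
- exact: ndiffW ng.
- by case: nf.
Qed.

Lemma ndiff_affine n f (s t : R) : ndiff n f -> ndiff n (fun x => f (s * x + t)).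
Proof.
elim: n f => // n IH f nf.
apply: (@ndiffS _ _ (fun x => s * derive1 f (s * x + t) + 0)) => [x|].
  rewrite addr0 mulrC.
  have D : is_derive x 1 (fun x => s * x + t) s.
    rewrite -[X in is_derive _ _ _ X]addr0 -[X in is_derive _ _ _ (X + _)]mulr1.
    exact: is_deriveD (is_deriveZ _ (is_derive_id _ _)) (is_derive_cst _ _ _).
  exact: (is_derive1_comp (ndiff_is_derive _ nf) D).
apply: ndiff_lin; first by apply: IH; case: nf.
elim: n {IH nf} => // n IH.
by apply: (@ndiffS _ _ (fun=> 0)) => // x; exact: is_derive_cst.
Qed.

Lemma exprn_le_expR n (y : R) : 0 <= y -> y ^+ n <= n`!%:R * expR y.
Proof.
case: n => [|n] y0; first by rewrite expr0 fact0 mul1r -expR0 ler_expR.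
rewrite -ler_pdivrMl ?ltr0n ?fact_gt0//.
apply: le_trans (expR_ge1Dxn n y0).
by rewrite mulrC lerDr.
Qed.

Lemma poly_le_expR p : exists2 C, 0 <= C & forall y, 0 <= y -> `|p.[y]| <= C * expR y.
Proof.
exists (\sum_(i < size p) `|p`_i| * i`!%:R).
  by apply: sumr_ge0 => i _; rewrite mulr_ge0.
move=> y y0; rewrite horner_coef mulr_suml (le_trans (ler_norm_sum _ _ _))//.
apply: ler_sum => i _; rewrite normrM -mulrA ler_wpM2l//.
by rewrite normrX ger0_norm// exprn_le_expR.
Qed.

(** The family p(1/x) exp(-1/x), indexed by polynomials, is closed under differentiation: p becomes
    X^2 (p - p'). Smoothness thus follows for all p at once, and [flat 1] is the classical
    exp(-1/x). *)
Definition flat p x : R := if 0 < x then p.[x^-1] * expR (- x^-1) else 0.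

(** Quadratic decay is what makes the derivative at 0 exist and vanish. It comes from bounding the
    polynomial X^2 p by a multiple of exp at 1/x. *)
Lemma flat_le_sqr p : exists2 C, 0 <= C & forall x, `|flat p x| <= C * x ^+ 2.
Proof.
have [C C0 HC] := poly_le_expR ('X^2 * p); exists C => // x.
rewrite /flat; case: ifPn => x0; last by rewrite normr0 mulr_ge0 ?sqr_ge0.
have y0 : 0 <= x^-1 by rewrite invr_ge0 ltW.
have := HC _ y0; rewrite hornerM hornerXn normrM ger0_norm ?exprn_ge0//.
rewrite normrM (ger0_norm (expR_ge0 _)) expRN exprVn => H.
rewrite ler_pdivrMr ?expR_gt0// mulrAC -ler_pdivrMr ?exprn_gt0// mulrC.
exact: H.
Qed.

Lemma flat_is_derive p x : is_derive x 1 (flat p) (flat ('X^2 * (p - deriv p)) x).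
Proof.
have [x0|x0|->] := ltgtP x 0.
- rewrite {2}/flat ltNge (ltW x0)/=.
  apply: (@near_is_derive _ (cst 0) _ (x - 1) 0); rewrite ?gtrBl//.
  by move=> y _ y0; rewrite /flat ltNge (ltW y0).
- rewrite {2}/flat x0.
  apply: (@near_is_derive _ (fun x => p.[x^-1] * expR (- x^-1)) _ 0 (x + 1)); rewrite ?ltrDl//.
    by move=> y y0 _; rewrite /flat y0.
  have xn0 : x != 0 by rewrite gt_eqF.
  have D1 : is_derive x 1 (fun y : R => y^-1) (- x ^- 2 *: 1).
    exact: (@is_deriveV _ id x).
  have D2 : is_derive x 1 (fun y => - y^-1) (- (- x ^- 2 *: 1)) by apply: is_deriveN.
  have D3 := is_derive1_comp (is_derive_poly p x^-1) D1.
  have D4 := @is_derive1_comp _ expR (fun y => - y^-1) _ _ _ (is_derive_expR (- x^-1)) D2.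
  apply: is_derive_eq (is_deriveM D3 D4) _.
  rewrite /= hornerM hornerXn hornerD hornerN exprVn.
  rewrite /GRing.scale/=; ring.
- rewrite {2}/flat ltxx; apply/is_derive1P => e e0.
  have [C C0 HC] := flat_le_sqr p; exists (e / (C + 1)).
    by rewrite divr_gt0// ltr_wpDl.
  move=> s; rewrite {2}/flat ltxx mul0r !subr0 => se.
  rewrite (le_trans (HC s))// -real_normK ?num_real// expr2 mulrA ler_wpM2r//.
  move: se; rewrite ltr_pdivlMr ?ltr_wpDl// => se.
  by rewrite mulrC (le_trans _ (ltW se))// ler_wpM2l// lerDl.
Qed.

Lemma ndiff_flat n p : ndiff n (flat p).
Proof. by elim: n p => // n IH p; apply: ndiffS (flat_is_derive p) (IH _). Qed.

(* Tends to the indicator of ]a, b[ as t -> +oo. *)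
Definition bump a b t x : R := flat 1 (t * (x - a)) * flat 1 (t * (b - x)).

Lemma bump_ndiff n a b t : ndiff n (bump a b t).
Proof.
apply: ndiff_mul.
  rewrite (_ : (fun _ => _) = fun x => flat 1 (t * x + - (t * a))).
    exact/ndiff_affine/ndiff_flat.
  by apply/funext => x; rewrite mulrBr.
rewrite (_ : (fun _ => _) = fun x => flat 1 (- t * x + t * b)).
  exact/ndiff_affine/ndiff_flat.
by apply/funext => x; congr flat; ring.
Qed.

Lemma flat1E x : flat 1 x = if 0 < x then expR (- x^-1) else 0.
Proof. by rewrite /flat hornerC mul1r. Qed.

Lemma flat1_ge0 x : 0 <= flat 1 x.
Proof. by rewrite flat1E; case: ifP => // _; exact: expR_ge0. Qed.

Lemma flat1_le1 x : flat 1 x <= 1.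
Proof.
rewrite flat1E; case: ifP => // x0.
by rewrite expR_le1 oppr_le0 invr_ge0 ltW.
Qed.

Lemma bump_ge0 a b t x : 0 <= bump a b t x.
Proof. by rewrite mulr_ge0// flat1_ge0. Qed.

Lemma bump_le1 a b t x : bump a b t x <= 1.
Proof. by rewrite mulr_ile1// ?flat1_ge0// flat1_le1. Qed.

Lemma bump_gt0 a b t x : 0 < t -> a < x < b -> 0 < bump a b t x.
Proof.
move=> t0 /andP[ax xb].
by rewrite mulr_gt0// flat1E mulr_gt0 ?subr_gt0// expR_gt0.
Qed.

Lemma bump_eq0 a b t x : 0 < t -> ~~ (a < x < b) -> bump a b t x = 0.
Proof.
move=> t0; rewrite negb_and -!leNgt => /orP[xa|bx]; rewrite /bump !flat1E.
  by rewrite pmulr_rgt0// subr_gt0 ltNge xa/= mul0r.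
by rewrite [X in _ * X]ifN ?mulr0// pmulr_rgt0// subr_gt0 -leNgt.
Qed.

Lemma flat1_cvg (y : R) : 0 < y -> flat 1 (n.+1%:R * y) @[n --> \oo] --> (1 : R).
Proof.
move=> y0; rewrite (_ : (fun _ => _) = fun n : nat => expR (- (n.+1%:R^-1 * y^-1))).
  rewrite [X in _ --> X](_ : _ = expR (- (0 * y^-1))); last by rewrite mul0r oppr0 expR0.
  apply: continuous_cvg; first exact: continuous_expR.
  by apply: cvgN; apply: cvgMl; exact: cvg_harmonic.
by apply/funext => n; rewrite flat1E mulr_gt0// invfM.
Qed.

Lemma bump_cvg a b x : a < x < b -> bump a b n.+1%:R x @[n --> \oo] --> (1 : R).
Proof.
move=> /andP[ax xb]; rewrite -[X in _ --> X]mulr1.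
by apply: cvgM; apply: flat1_cvg; rewrite subr_gt0.
Qed.

Lemma test_fun_ndiff f a b : 0 < a -> b < 1 -> (forall n, ndiff n f) ->
  (forall y, ~~ (a <= y <= b) -> f y = 0) -> test_fun f.
Proof.
move=> a0 b1 nf f0; split; first exact/ndiff_derive1n.
by exists a, b; split => // y; rewrite in_itv/=; exact: f0.
Qed.

Lemma test_fun_bump a b t : 0 < t -> 0 < a -> b < 1 -> test_fun (bump a b t).
Proof.
move=> t0 a0 b1; apply: (@test_fun_ndiff _ a b) => //.
  by move=> n; exact: bump_ndiff.
move=> y; rewrite negb_and -!ltNge => H; apply: bump_eq0 => //.
by rewrite negb_and -!leNgt; case/orP: H => /ltW ->; rewrite ?orbT.
Qed.

Lemma test_fun_lin f g (c : R) : test_fun f -> test_fun g -> test_fun (fun x => c * f x + g x).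
Proof.
move=> [/ndiff_derive1n nf [a [b [a0 b1 f0]]]] [/ndiff_derive1n ng [a' [b' [a'0 b'1 g0]]]].
apply: (@test_fun_ndiff _ (Num.min a a') (Num.max b b')).
- by rewrite lt_min a0.
- by rewrite gt_max b1.
- by move=> n; exact: ndiff_lin.
- move=> y H; rewrite f0 ?g0 ?mulr0 ?addr0//; rewrite in_itv/=; apply: contra H.
    by move=> /andP[H1 H2]; rewrite ge_min le_max H1 H2 !orbT.
  by move=> /andP[H1 H2]; rewrite ge_min le_max H1 H2.
Qed.

Lemma test_fun_derive1 f : test_fun f -> test_fun (derive1 f).
Proof.
move=> [/ndiff_derive1n nf [a [b [a0 b1 f0]]]].
apply: (@test_fun_ndiff _ a b) => //.
  by move=> n; case: (nf n.+1).
move=> y; rewrite negb_and -!ltNge => H.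
apply: is_derive_derive1; case/orP: H => H.
  apply: (@near_is_derive _ (cst 0) _ (y - 1) a); rewrite ?gtrBl//.
  by move=> z _ za; rewrite f0// in_itv/= leNgt za.
apply: (@near_is_derive _ (cst 0) _ b (y + 1)); rewrite ?ltrDl//.
by move=> z bz _; rewrite f0// in_itv/= [z <= b]leNgt bz andbF.
Qed.

Lemma test_fun_is_derive f x : test_fun f -> is_derive x 1 f (derive1 f x).
Proof. by move=> [/ndiff_derive1n nf _]; apply: ndiff_is_derive (nf 1%N). Qed.

Lemma test_fun_continuous f : test_fun f -> continuous f.
Proof. by move=> tf x; apply: is_derive_cvg (test_fun_is_derive x tf). Qed.

End Smooth.

(** * The du Bois-Reymond lemma on the unit interval *)

Section DuBoisReymond.
Context {R : realType}.
Implicit Types (f g h F : R -> R) (a b x : R).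
Notation mu := (@lebesgue_measure R).

(** Passes to a compact interval, on which functions that are regular only inside ]0, 1[ are
    continuous up to the end points. *)
Lemma Rintegral01_supp h a b : 0 < a -> b < 1 ->
  (forall y, ~~ (a <= y <= b) -> h y = 0) ->
  \int[mu01]_y h y = \int[mu]_(y in `[a, b]) h y.
Proof.
move=> a0 b1 h0; rewrite /Rintegral; congr fine.
transitivity (\int[@mu01 R]_(y in `[a, b]) (h y)%:E)%E.
  rewrite [RHS]integral_mkcond; apply: eq_integral => y _.
  rewrite patchE; case: ifPn => //; rewrite mem_setE in_itv/= => yab.
  by rewrite h0.
apply: eq_measure_integral => A mA AD.
rewrite /mu01/= /mrestr setIidl// => y /AD /=; rewrite !in_itv/= => /andP[ay yb].
by rewrite (lt_le_trans a0 ay) (le_lt_trans yb b1).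
Qed.

Lemma within_continuous_oo f a b x : {within `[a, b], continuous f} ->
  a < x < b -> {for x, continuous f}.
Proof.
move=> /(continuous_subspaceW (@subset_itv_oo_cc _ _ a b)).
rewrite continuous_open_subspace; last exact: interval_open.
by move=> H xab; apply: H; rewrite inE/= in_itv/=.
Qed.

Lemma continuous_within f a b :
  (forall x, a <= x <= b -> {for x, continuous f}) -> {within `[a, b], continuous f}.
Proof.
by move=> H; apply: continuous_in_subspaceT => x; rewrite inE/= in_itv/=; exact: H.
Qed.

Lemma Rintegral_FTC F f a b : a < b ->
  (forall x, a <= x <= b -> is_derive x 1 F (f x)) ->
  {within `[a, b], continuous f} ->
  \int[mu]_(x in `[a, b]) f x = F b - F a.
Proof.
move=> ab dF cf; rewrite /Rintegral (@continuous_FTC2 _ f F)//.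
- have cF x : a <= x <= b -> {for x, continuous F} by move=> /dF /is_derive_cvg.
  split.
  + by move=> x; rewrite in_itv/= => /andP[/ltW ax /ltW xb]; case: (dF x); rewrite ?ax.
  + by apply: cvg_at_right_filter; apply: cF; rewrite lexx ltW.
  + by apply: cvg_at_left_filter; apply: cF; rewrite lexx ltW.
- move=> x; rewrite in_itv/= => /andP[/ltW ax /ltW xb].
  by apply: is_derive_derive1; apply: dF; rewrite ax.
Qed.

Lemma integrable_cc f a b : (forall x, a <= x <= b -> {for x, continuous f}) ->
  mu.-integrable `[a, b] (EFin \o f).
Proof.
move=> cf; apply: continuous_compact_integrable; first exact: segment_compact.
exact: continuous_within.
Qed.

Lemma Rintegral_by_parts01 (E e th : R -> R) :
  (forall x, 0 < x < 1 -> is_derive x 1 E (e x)) ->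
  (forall x, 0 < x < 1 -> {for x, continuous e}) -> test_fun th ->
  \int[mu01]_x (E x * derive1 th x) = - \int[mu01]_x (e x * th x).
Proof.
move=> dE ce tth; have [_ [a [b [a0 b1 th0]]]] := tth.
have [_ [a' [b' [a'0 b'1 th'0]]]] := test_fun_derive1 tth.
(* The interval [l, r] strictly contains both supports, so th vanishes at its ends. The thresholds 1
   / 3 and 2 / 3 force l < r, because [test_fun] allows a > b when th is zero. *)
pose l := Num.min (Num.min a a') (1 / 3) / 2.
pose r := (Num.max (Num.max b b') (2 / 3) + 1) / 2.
have [la la' l3 l0] : [/\ l < a, l < a', l < 1 / 3 & 0 < l].
  have : Num.min (Num.min a a') (1 / 3) <= Num.min (Num.min a a') (1 / 3) by [].
  rewrite le_min le_min => /andP[/andP[? ?] ?].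
  have : 0 < Num.min (Num.min a a') (1 / 3) by rewrite !lt_min a0 a'0/=; lra.
  by rewrite /l => ?; split; lra.
have [br b'r r3 r1] : [/\ b < r, b' < r, 2 / 3 < r & r < 1].
  have : Num.max (Num.max b b') (2 / 3) <= Num.max (Num.max b b') (2 / 3) by [].
  rewrite ge_max ge_max => /andP[/andP[? ?] ?].
  have : Num.max (Num.max b b') (2 / 3) < 1 by rewrite !gt_max b1 b'1/=; lra.
  by rewrite /r => ?; split; lra.
have lr : l < r by lra.
have lr01 x : l <= x <= r -> 0 < x < 1.
  by move=> /andP[lx xr]; rewrite (lt_le_trans l0 lx) (le_lt_trans xr r1).
have out y c d : l < c -> d < r -> ~~ (l < y < r) -> y \notin `[c, d].
  move=> lc dr; rewrite in_itv/=; apply: contra => /andP[cy yd].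
  by rewrite (lt_le_trans lc cy) (le_lt_trans yd dr).
have th0' y : ~~ (l < y < r) -> th y = 0 by move=> H; apply: th0; apply: out H.
have th'0' y : ~~ (l < y < r) -> derive1 th y = 0 by move=> H; apply: th'0; apply: out H.
have lrW y : ~~ (l <= y <= r) -> ~~ (l < y < r).
  by apply: contra => /andP[/ltW -> /ltW ->].
rewrite !(@Rintegral01_supp _ l r)//; last 2 first.
- by move=> y /lrW H; rewrite th0' ?mulr0.
- by move=> y /lrW H; rewrite th'0' ?mulr0.
have cE x : l <= x <= r -> {for x, continuous E} by move=> /lr01 /dE /is_derive_cvg.
have cth x : {for x, continuous th} by exact: test_fun_continuous.
have cth' x : {for x, continuous (derive1 th)} by exact/test_fun_continuous/test_fun_derive1.
have c1 x : l <= x <= r -> {for x, continuous (fun x => E x * derive1 th x)}.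
  by move=> xlr; apply: cvgM; [exact: cE|exact: cth'].
have c2 x : l <= x <= r -> {for x, continuous (fun x => e x * th x)}.
  by move=> xlr; apply: cvgM; [exact/ce/lr01|exact: cth].
apply/eqP; rewrite -addr_eq0 -RintegralD//; [|exact: integrable_cc..].
have D x : l <= x <= r -> is_derive x 1 (fun x => E x * th x) (E x * derive1 th x + e x * th x).
  move=> xlr; have D := is_deriveM (dE _ (lr01 _ xlr)) (test_fun_is_derive x tth).
  by apply: is_derive_eq D _; rewrite /GRing.scale/= [X in _ + X]mulrC.
rewrite (Rintegral_FTC lr D) ?th0' ?ltxx ?andbF// ?mulr0 ?subrr//.
by apply: continuous_within => x xlr; apply: cvgD; [exact: c1|exact: c2].
Qed.

(** Cutting [A - A a] off outside ]a, b[ preserves differentiability: f vanishes there, so A is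
    constant on either side, and [A a = A b] makes both constants agree. *)
Lemma antiderivative_supp f a b A : a < b ->
  (forall x, a - 1 < x < b + 1 -> is_derive x 1 A (f x)) -> A a = A b ->
  (forall y, ~~ (a < y < b) -> f y = 0) ->
  exists2 th : R -> R, (forall x, is_derive x 1 th (f x)) &
    (forall y, ~~ (a < y < b) -> th y = 0).
Proof.
move=> ab dA Aab f0; exists (fun x => if a < x < b then A x - A a else 0); last first.
  by move=> y /negbTE ->.
have AL x : a - 1 < x -> x <= a -> A x = A a.
  move=> ax xa; have [|c] := @MVT_sym _ A f x a.
    by move=> y; rewrite min_l// max_r// => /andP[? ?]; apply: dA; apply/andP; split; lra.
  rewrite min_l// max_r// => /andP[xc ca]; rewrite f0 ?mul0r; last by rewrite (ltNge a) ca.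
  by move/eqP; rewrite subr_eq0 => /eqP.
have AR x : b <= x -> x < b + 1 -> A x = A b.
  move=> bx xb; have [|c] := @MVT_sym _ A f b x.
    by move=> y; rewrite min_l// max_r// => /andP[? ?]; apply: dA; apply/andP; split; lra.
  rewrite min_l// max_r// => /andP[bc cx]; rewrite f0 ?mul0r; last by rewrite (ltNge _ b) bc andbF.
  by move/eqP; rewrite subr_eq0 => /eqP.
have E x : a - 1 < x -> x < b + 1 ->
    A x - A a = if a < x < b then A x - A a else 0.
  move=> ax xb; have [xa|ax'] := leP x a; first by rewrite AL// subrr.
  by have [bx|//] := leP b x; rewrite AR// Aab subrr.
move=> x; have [xa|ax] := ltP x a.
  rewrite f0; last by rewrite (ltNge a) (ltW xa).
  apply: (@near_is_derive _ (cst 0) _ (x - 1) a); rewrite ?gtrBl//.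
  by move=> z _ za; rewrite (ltNge a) (ltW za).
have [bx|xb] := ltP b x.
  rewrite f0; last by rewrite (ltNge _ b) (ltW bx) andbF.
  apply: (@near_is_derive _ (cst 0) _ b (x + 1)); rewrite ?ltrDl//.
  by move=> z bz _; rewrite (ltNge _ b) (ltW bz) andbF.
apply: (@near_is_derive _ (fun x => A x - A a) _ (a - 1) (b + 1)) => //; [lra|lra|].
have dx : is_derive x 1 A (f x) by apply: dA; apply/andP; split; lra.
by rewrite -[X in is_derive _ _ _ X]subr0; exact: is_deriveB dx (is_derive_cst _ _ _).
Qed.

Lemma is_derive_ge0_le F f x y : x <= y ->
  (forall z, x <= z <= y -> is_derive z 1 F (f z)) ->
  (forall z, x <= z <= y -> 0 <= f z) -> F x <= F y.
Proof.
move=> xy dF f0; have [|c] := @MVT_sym _ F f x y.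
  by move=> z; rewrite min_l// max_r//; exact: dF.
rewrite min_l// max_r// => cxy NE; rewrite -subr_ge0 NE.
by rewrite mulr_ge0 ?subr_ge0// f0.
Qed.

Lemma is_derive_eq0_cst F f x y : x <= y ->
  (forall z, x <= z <= y -> is_derive z 1 F (f z)) ->
  (forall z, x <= z <= y -> f z = 0) -> F x = F y.
Proof.
move=> xy dF f0; have [|c] := @MVT_sym _ F f x y.
  by move=> z; rewrite min_l// max_r//; exact: dF.
by rewrite min_l// max_r// => /f0 ->; rewrite mul0r => /eqP; rewrite subr_eq0 => /eqP.
Qed.

(** Plays the role of the fact that a nonnegative continuous function with zero integral vanishes: F
    is monotone with equal end values, hence constant. *)
Lemma is_derive_ge0_eq F f x y : x <= y ->
  (forall z, x <= z <= y -> is_derive z 1 F (f z)) ->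
  (forall z, x <= z <= y -> 0 <= f z) -> F x = F y ->
  forall c, x < c < y -> f c = 0.
Proof.
move=> xy dF f0 Fxy c /andP[xc cy].
have Fc z : x <= z <= y -> F z = F x.
  move=> /andP[xz zy]; apply/eqP; rewrite eq_le; apply/andP; split.
    by rewrite Fxy; apply: (is_derive_ge0_le zy) => w /andP[zw wy];
      [apply: dF|apply: f0]; rewrite wy (le_trans xz).
  by apply: (is_derive_ge0_le xz) => w /andP[zw wy];
    [apply: dF|apply: f0]; rewrite zw (le_trans wy).
have D : is_derive c 1 F 0.
  apply: (@near_is_derive _ (cst (F x)) _ x y) => // z xz zy.
  by rewrite Fc// !ltW.
by rewrite -(is_derive_derive1 D); apply/esym/is_derive_derive1/dF; rewrite !ltW.
Qed.

(** The constant c equalizes the masses of the two bumps, so that an antiderivative of their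
    difference can vanish on both sides of their supports. *)
Lemma test_fun_bump_diff (p q d : R) : 0 < d -> 0 < p - d -> p + d < 1 ->
  0 < q - d -> q + d < 1 ->
  exists c th, [/\ 0 < c, test_fun th &
    derive1 th = fun x => c * bump (q - d) (q + d) 1 x - bump (p - d) (p + d) 1 x].
Proof.
move=> d0 dp0 dp1 dq0 dq1.
pose bp := bump (p - d) (p + d) 1; pose bq := bump (q - d) (q + d) 1.
have wide (z : R) : 0 <= z <= 1 -> -1 < z < 2.
  by clear => /andP[? ?]; apply/andP; split; lra.
have cbump (u v : R) : continuous (bump u v 1).
  by move=> x; exact: is_derive_cvg (ndiff_is_derive x (bump_ndiff 1 u v 1)).
have m12 : (-1 : R) < 2 by clear; lra.
have [Ap dAp] : exists A : R -> R, forall x, -1 < x < 2 -> is_derive x 1 A (bp x).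
  by apply: antiderivative => //; apply: continuous_within => x _; exact: cbump.
have [Aq dAq] : exists A : R -> R, forall x, -1 < x < 2 -> is_derive x 1 A (bq x).
  by apply: antiderivative => //; apply: continuous_within => x _; exact: cbump.
(* Positivity of the mass of a bump, read off as an increment of its antiderivative: equal end
   values would force the bump to vanish. *)
have incr (A f : R -> R) (c : R) : 0 < c < 1 -> (forall x, -1 < x < 2 -> is_derive x 1 A (f x)) ->
    (forall x, 0 <= f x) -> 0 < f c -> A 0 < A 1.
  move=> c01 dA f0 fc.
  have dA' (z : R) : 0 <= z <= 1 -> is_derive z 1 A (f z) by move=> /wide; exact: dA.
  rewrite lt_neqAle (is_derive_ge0_le ler01 dA')// andbT.
  apply/negP => /eqP A01.
  have fc0 := is_derive_ge0_eq ler01 dA' (fun z _ => f0 z) A01 c01.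
  by move: fc; rewrite fc0 ltxx.
have in01 (c : R) : 0 < c - d -> c + d < 1 -> 0 < c < 1 /\ c - d < c < c + d.
  by clear -d0 => ? ?; split; apply/andP; split; lra.
have [p01 dpI] := in01 _ dp0 dp1; have [q01 dqI] := in01 _ dq0 dq1.
have Ap01 : Ap 0 < Ap 1.
  by apply: (incr _ bp p) => //; [move=> x; exact: bump_ge0|exact: bump_gt0].
have Aq01 : Aq 0 < Aq 1.
  by apply: (incr _ bq q) => //; [move=> x; exact: bump_ge0|exact: bump_gt0].
(* The ratio of the masses of the bumps at p and at q. *)
pose c := (Ap 1 - Ap 0) / (Aq 1 - Aq 0).
have c0 : 0 < c by rewrite divr_gt0 ?subr_gt0.
pose f x := c * bq x - bp x.
pose A x := c * Aq x - Ap x.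
have dA (x : R) : -1 < x < 2 -> is_derive x 1 A (f x).
  by move=> x12; exact: is_deriveB (is_deriveZ _ (dAq _ x12)) (dAp _ x12).
have A01 : A 0 = A 1.
  apply/eqP; rewrite -subr_eq0 /A /c; apply/eqP; field.
  by rewrite subr_eq0 gt_eqF.
pose l := Num.min (p - d) (q - d); pose r := Num.max (p + d) (q + d).
have l0 : 0 < l by rewrite lt_min dp0.
have r1 : r < 1 by rewrite gt_max dp1.
have lr : l < r.
  by case/andP: dpI => dp dp'; rewrite gt_min lt_max (lt_trans dp dp').
have fout (y : R) : ~~ (l < y < r) -> f y = 0.
  move=> H; rewrite /f /bq /bp !bump_eq0 ?mulr0 ?subrr//; apply: contra H => /andP[H1 H2];
  by rewrite gt_min lt_max H1 H2 ?orbT.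
have Aout (x y : R) : 0 <= x -> y <= 1 -> x <= y -> (forall z, x <= z <= y -> f z = 0) -> A x = A y.
  move=> x0 y1 xy f0; apply: (is_derive_eq0_cst xy _ f0) => z /andP[xz zy].
  by apply/dA/wide; rewrite (le_trans x0) ?(le_trans zy).
have Alr : A l = A r.
  have A0l : A 0 = A l.
    apply: Aout => //; [exact: ltW (lt_trans lr r1)|exact: ltW|].
    by move=> z /andP[_ zl]; apply: fout; rewrite (ltNge l) zl.
  have Ar1 : A r = A 1.
    apply: Aout => //; [exact: ltW (lt_trans l0 lr)|exact: ltW|].
    by move=> z /andP[rz _]; apply: fout; rewrite (ltNge _ r) rz andbF.
  by rewrite -A0l A01 Ar1.
have [|th dth th0] := @antiderivative_supp f l r A lr _ Alr fout.
  by move=> x; clear -l0 r1 dA => /andP[x1 x2]; apply: dA; apply/andP; split; lra.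
exists c, th; split => //; last by apply/funext => x; exact: is_derive_derive1.
apply: (@test_fun_ndiff _ _ l r) => //.
  move=> [//|n]; apply: (ndiffS dth).
  (* Writing -bp as -2 bp + bp again fits the shape of [ndiff_lin]. *)
  rewrite (_ : f = fun x => c * bq x + (- 2 * bp x + bp x)).
    apply: ndiff_lin; first exact (bump_ndiff n (q - d) (q + d) 1).
    by apply: ndiff_lin; exact (bump_ndiff n (p - d) (p + d) 1).
  by apply/funext => x; rewrite /f; ring.
by move=> y H; apply: th0; apply: contra H => /andP[/ltW -> /ltW ->].
Qed.

(** Take th increasing near q, where F exceeds the midpoint m, and decreasing near p, where F is
    below m. Then (F - m) th' is nonnegative and has zero integral, yet it is positive at p. *)
Lemma du_bois_reymond_lt F p q : (forall x, 0 < x < 1 -> {for x, continuous F}) ->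
  (forall th, test_fun th -> \int[mu01]_x (F x * derive1 th x) = 0) ->
  0 < p < 1 -> 0 < q < 1 -> F p < F q -> False.
Proof.
move=> cF F0 p01 q01 Fpq.
pose m := (F p + F q) / 2.
have Fpm : F p < m by rewrite /m; lra.
have mFq : m < F q by rewrite /m; lra.
have [d d0 [[dp0 dp1] [dq0 dq1] Fp Fq]] : exists2 d, 0 < d & [/\ 0 < p - d /\ p + d < 1, 0 < q - d /\ q + d < 1,
   (forall x, `|x - p| < d -> F x < m) & (forall x, `|x - q| < d -> m < F x)].
  have [d1 /= d10 H1] : \forall x \near p, F x < m.
    exact (@cvgr_lt R R (nbhs p) _ F (F p) (cF _ p01) m Fpm).
  have [d2 /= d20 H2] : \forall x \near q, m < F x.
    exact (@cvgr_gt R R (nbhs q) _ F (F q) (cF _ q01) m mFq).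
  move: p01 q01 => /andP[p0 p1] /andP[q0 q1].
  pose d := Num.min (Num.min d1 d2) (Num.min (Num.min p (1 - p)) (Num.min q (1 - q))).
  have dd0 : 0 < d by rewrite !lt_min d10 d20 p0 q0 !subr_gt0 p1.
  have : d <= d by []; rewrite {2}/d !le_min => /andP[/andP[? ?] /andP[/andP[? ?] /andP[? ?]]].
  exists (d / 2); first by rewrite divr_gt0.
  split; [split; lra|split; lra| |].
  - by move=> x xd; apply: H1; rewrite /= distrC; lra.
  - by move=> x xd; apply: H2; rewrite /= distrC; lra.
have [c [th [c0 tth th'E]]] := test_fun_bump_diff d0 dp0 dp1 dq0 dq1.
pose bp := bump (p - d) (p + d) 1; pose bq := bump (q - d) (q + d) 1.
have [_ [a [b [a0 b1 th0]]]] := tth.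
have cth' : continuous (derive1 th) by exact/test_fun_continuous/test_fun_derive1.
pose l := Num.min (a / 2) (p - d); pose r := Num.max ((b + 1) / 2) (p + d).
have l0 : 0 < l by rewrite lt_min dp0 divr_gt0.
have r1 : r < 1 by rewrite gt_max dp1; clear -b1; lra.
have la : l < a by rewrite gt_min; clear -a0; apply/orP; left; lra.
have br : b < r by rewrite lt_max; clear -b1; apply/orP; left; lra.
have plr : l < p < r by rewrite gt_min lt_max gtrBl ltrDl d0 !orbT.
have lr : l < r by case/andP: plr => /lt_trans; exact.
have thout (y : R) : ~~ (l < y < r) -> th y = 0.
  move=> H; apply: th0; rewrite in_itv/=; apply: contra H => /andP[ay yb].
  by rewrite (lt_le_trans la) ?(le_lt_trans yb).
have th'out (y : R) : ~~ (l <= y <= r) -> derive1 th y = 0.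
  rewrite negb_and -!ltNge => H; apply: is_derive_derive1; case/orP: H => H.
    apply: (@near_is_derive _ (cst 0) _ (y - 1) l); rewrite ?gtrBl//.
    by move=> z _ zl; rewrite thout// (ltNge l) (ltW zl).
  apply: (@near_is_derive _ (cst 0) _ r (y + 1)); rewrite ?ltrDl//.
  by move=> z rz _; rewrite thout// (ltNge _ r) (ltW rz) andbF.
have lr01 (x : R) : l <= x <= r -> 0 < x < 1.
  by move=> /andP[lx xr]; rewrite (lt_le_trans l0 lx) (le_lt_trans xr r1).
have [N dN] : exists N : R -> R, forall x, l / 2 < x < (r + 1) / 2 ->
    is_derive x 1 N (F x * derive1 th x).
  apply: antiderivative; first by clear -l0 r1 lr; lra.
  apply: continuous_within => x xlr; apply: cvgM; last exact: cth'.
  by apply: cF; move: xlr; clear -l0 r1 => /andP[? ?]; apply/andP; split; lra.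
have dN' (x : R) : l <= x <= r -> is_derive x 1 N (F x * derive1 th x).
  by move=> xlr; apply: dN; move: xlr; clear -l0 r1 => /andP[? ?]; apply/andP; split; lra.
have Nlr : N l = N r.
  have := F0 _ tth; rewrite (@Rintegral01_supp _ l r)//; last first.
    by move=> y H; rewrite th'out ?mulr0.
  rewrite (Rintegral_FTC lr dN'); last first.
    by apply: continuous_within => x /lr01 x01; apply: cvgM; [exact: cF|exact: cth'].
  by move/eqP; rewrite subr_eq0 => /eqP.
(* M is an antiderivative of (F - m) th'. Its values at l and r agree because N has equal values
   there and th vanishes at both points. *)
pose M x := N x - m * th x.
pose g x := (F x - m) * derive1 th x.
have dM (x : R) : l <= x <= r -> is_derive x 1 M (g x).
  move=> /dN' D; rewrite /g mulrBl.
  exact: is_deriveB D (is_deriveZ _ (test_fun_is_derive x tth)).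
have nearI (c' x : R) : c' - d < x < c' + d -> `|x - c'| < d.
  by clear => /andP[? ?]; rewrite ltr_norml; apply/andP; split; lra.
have g0 x : 0 <= g x.
  rewrite /g th'E; have [xp|xp] := boolP (p - d < x < p + d).
    have Fxm := Fp _ (nearI _ _ xp).
    have xq : ~~ (q - d < x < q + d).
      by apply/negP => /nearI /Fq; rewrite ltNge (ltW Fxm).
    rewrite (bump_eq0 _ xq)// mulr0 sub0r mulrN -mulNr mulr_ge0 ?bump_ge0//.
    by rewrite oppr_ge0 subr_le0 ltW.
  rewrite (bump_eq0 _ xp)// subr0.
  have [xq|xq] := boolP (q - d < x < q + d); last by rewrite bump_eq0// !mulr0.
  apply: mulr_ge0; last by rewrite mulr_ge0 ?bump_ge0// ltW.
  by rewrite subr_ge0 ltW// Fq// nearI.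
have Mlr : M l = M r by rewrite /M Nlr !thout ?ltxx ?andbF.
have := is_derive_ge0_eq (ltW lr) dM (fun x _ => g0 x) Mlr plr.
have ppd : p - d < p < p + d by rewrite gtrBl ltrDl d0.
have pq : ~~ (q - d < p < q + d).
  by apply/negP => /nearI /Fq; rewrite ltNge (ltW Fpm).
rewrite /g th'E (bump_eq0 _ pq)// mulr0 sub0r => /eqP.
rewrite mulf_eq0 subr_eq0 lt_eqF//= oppr_eq0 gt_eqF//.
exact: bump_gt0.
Qed.

Lemma du_bois_reymond F : (forall x, 0 < x < 1 -> {for x, continuous F}) ->
  (forall th, test_fun th -> \int[mu01]_x (F x * derive1 th x) = 0) ->
  forall p q, 0 < p < 1 -> 0 < q < 1 -> F p = F q.
Proof.
move=> cF F0 p q p01 q01.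
by have [/(du_bois_reymond_lt cF F0 p01 q01)|/(du_bois_reymond_lt cF F0 q01 p01)|] := ltgtP (F p) (F q).
Qed.

(** Subtracting from f an antiderivative of e leaves a continuous function with zero weak
    derivative, which is constant by [du_bois_reymond]. *)
Lemma weak_derivative_is_derive f (e : R -> R) :
  {within `[(0 : R), 1], continuous f} -> {within `[(0 : R), 1], continuous e} ->
  (forall th, test_fun th ->
     \int[mu01]_x (f x * derive1 th x) = - \int[mu01]_x (e x * th x)) ->
  forall x, 0 < x < 1 -> is_derive x 1 f (e x).
Proof.
move=> cf ce fe.
have cf' x : 0 < x < 1 -> {for x, continuous f} by exact: within_continuous_oo.
have ce' x : 0 < x < 1 -> {for x, continuous e} by exact: within_continuous_oo.
have [E dE] := antiderivative ltr01 ce.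
have cE (x : R) : 0 < x < 1 -> {for x, continuous E} by move=> /dE /is_derive_cvg.
have cst_fE : forall p q, 0 < p < 1 -> 0 < q < 1 -> f p - E p = f q - E q.
  apply: (@du_bois_reymond (fun x => f x - E x)).
    by move=> x x01; apply: cvgB; [exact: cf'|exact: cE].
  move=> th tth; have [_ [a [b [a0 b1 th'0]]]] := test_fun_derive1 tth.
  have ab01 x : a <= x <= b -> 0 < x < 1.
    by move=> /andP[ax xb]; rewrite (lt_le_trans a0 ax) (le_lt_trans xb b1).
  have out (k : R -> R) y : ~~ (a <= y <= b) -> k y * derive1 th y = 0.
    by move=> H; rewrite th'0 ?mulr0// in_itv.
  have cth' x : {for x, continuous (derive1 th)} by exact/test_fun_continuous/test_fun_derive1.
  rewrite (@Rintegral01_supp _ a b)//; last by move=> y H; exact: (out (fun x => f x - E x)).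
  under eq_Rintegral do rewrite mulrBl.
  rewrite RintegralB//.
  - rewrite -!(@Rintegral01_supp _ a b)//; [|exact: out..].
    by rewrite fe// Rintegral_by_parts01// subrr.
  - by apply: integrable_cc => x /ab01 x01; apply: cvgM; [exact: cf'|exact: cth'].
  - by apply: integrable_cc => x /ab01 x01; apply: cvgM; [exact: cE|exact: cth'].
move=> x x01; case/andP: (x01) => x0 x1.
apply: (@near_is_derive _ (fun y => E y + (f x - E x)) _ 0 1) => //.
  move=> y y0 y1; rewrite (cst_fE x y)//; first by rewrite addrC subrK.
  by rewrite y0.
by rewrite -[X in is_derive _ _ _ X]addr0; exact: is_deriveD (dE _ x01) (is_derive_cst _ _ _).
Qed.

End DuBoisReymond.

(** * Semi-inner products, L^2 and H^1 *)

Section SemiInner.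
Context {R : realType}.
Implicit Types (f g h : R -> R) (a x : R) (X : set (R -> R)).

(** Only positive semidefinite, as functions equal almost everywhere are not identified. Bilinearity
    is restricted to X, outside of which integrals and weak derivatives take default values. Both
    [L2ip] and [H1ip] are instances. *)
Definition semi_inner X (B : (R -> R) -> (R -> R) -> R) : Prop :=
  [/\ X (fun=> 0), (forall a f g, X f -> X g -> X (fun y => a * f y + g y)),
     (forall a f g h, X f -> X g -> X h ->
        B (fun y => a * f y + g y) h = a * B f h + B g h),
     (forall f g, B f g = B g f) & (forall f, X f -> 0 <= B f f)].

Context (X : set (R -> R)) (B : (R -> R) -> (R -> R) -> R) (HB : semi_inner X B).
Let N f := Num.sqrt (B f f).

Lemma semi_inner_sqr f : X f -> N f ^+ 2 = B f f.
Proof. by case: HB => _ _ _ _ + Xf => /(_ _ Xf) B0; rewrite sqr_sqrtr. Qed.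

Lemma semi_inner_quad a f g : X f -> X g ->
  B (fun y => a * f y + g y) (fun y => a * f y + g y)
  = a ^+ 2 * B f f + 2 * a * B f g + B g g.
Proof.
case: HB => _ XL BL BC _ Xf Xg; have Xfg := XL a _ _ Xf Xg.
rewrite BL// (BC f) (BC g) !BL// (BC g f); ring.
Qed.

Lemma semi_inner_CS f g : X f -> X g -> `|B f g| <= N f * N g.
Proof.
move=> Xf Xg; case: (HB) => _ XL BL BC B0.
rewrite /N -sqrtrM ?B0// -sqrtr_sqr ler_wsqrtr//.
have H a : 0 <= a ^+ 2 * B f f + 2 * a * B f g + B g g.
  by rewrite -semi_inner_quad//; apply/B0/XL.
have [A0|A0] := eqVneq (B f f) 0.
  suff -> : B f g = 0 by rewrite A0 mul0r expr0n.
  apply/eqP; rewrite -[_ == 0]negbK; apply/negP => C0.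
  (* With [B f f = 0] the quadratic polynomial is affine in a, and this a gives it the value -1. *)
  have := H (- (B g g + 1) / (2 * B f g)).
  rewrite A0 mulr0 add0r (_ : _ + _ = -1); last by field.
  by rewrite oppr_ge0 ler10.
have Ap : 0 < B f f by rewrite lt_neqAle eq_sym A0 B0.
have := H (- B f g / B f f).
rewrite (_ : _ + _ = (B f f * B g g - B f g ^+ 2) / B f f); last by field.
by rewrite pmulr_lge0 ?invr_gt0// subr_ge0.
Qed.

Lemma semi_norm_lin a f g : X f -> X g ->
  N (fun y => a * f y + g y) <= `|a| * N f + N g.
Proof.
move=> Xf Xg; case: (HB) => _ XL _ _ B0.
rewrite -(@ler_pXn2r _ 2) ?nnegrE ?addr_ge0 ?mulr_ge0 ?sqrtr_ge0//.
rewrite semi_inner_sqr; last exact: XL.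
rewrite semi_inner_quad// sqrrD exprMn !semi_inner_sqr// -normrX.
rewrite (ger0_norm (sqr_ge0 a)) lerD2r lerD2l -mulrA -[leRHS]mulr_natl ler_wpM2l//.
rewrite (le_trans (ler_norm _))// normrM -mulrA ler_wpM2l//.
exact: semi_inner_CS.
Qed.

Lemma semi_inner_closedB f g : X f -> X g -> X (fun y => f y - g y).
Proof.
move=> Xf Xg; case: HB => _ XL _ _ _.
rewrite (_ : (fun _ => _) = fun y => -1 * g y + f y); first exact: XL.
by apply/funext => y; ring.
Qed.

Lemma semi_innerBl f g h : X f -> X g -> X h ->
  B (fun y => f y - g y) h = B f h - B g h.
Proof.
move=> Xf Xg Xh; case: HB => _ _ BL _ _.
rewrite (_ : (fun _ => _) = fun y => -1 * g y + f y).
  by rewrite BL//; ring.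
by apply/funext => y; ring.
Qed.

Lemma semi_innerZl a f h : X f -> X h -> B (fun y => a * f y) h = a * B f h.
Proof.
move=> Xf Xh; case: HB => X0 _ BL _ _.
have B0 : B (fun=> 0) h = 0.
  have := BL 1 _ _ _ X0 X0 Xh; rewrite (_ : (fun y : R => 1 * 0 + 0) = fun=> 0).
    by rewrite mul1r => /eqP; rewrite addrC -subr_eq subrr eq_sym => /eqP.
  by apply/funext => y; ring.
rewrite (_ : (fun _ => _) = fun y => a * f y + 0).
  by rewrite BL// B0 addr0.
by apply/funext => y; ring.
Qed.

Lemma semi_norm0 : N (fun=> 0) = 0.
Proof.
case: (HB) => X0 _ _ _ _; rewrite /N.
rewrite (_ : (fun=> 0) = fun y : R => 0 * 0).
  by rewrite {2}(_ : (fun y : R => 0 * 0) = fun=> 0) ?semi_innerZl// ?mul0r ?sqrtr0//; apply/funext => y; rewrite mul0r.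
by apply/funext => y; rewrite mul0r.
Qed.

Lemma semi_normB f g : X f -> X g -> N (fun y => f y - g y) <= N f + N g.
Proof.
move=> Xf Xg; rewrite (_ : (fun _ => _) = fun y => -1 * g y + f y).
  by rewrite (le_trans (semi_norm_lin _ _ _))// normrN1 mul1r addrC.
by apply/funext => y; ring.
Qed.

Lemma semi_norm_distC f g : X f -> X g ->
  N (fun y => f y - g y) = N (fun y => g y - f y).
Proof.
move=> Xf Xg; rewrite /N; congr Num.sqrt; case: (HB) => _ _ _ BC _.
have X1 := semi_inner_closedB Xf Xg; have X2 := semi_inner_closedB Xg Xf.
by rewrite !semi_innerBl// !(BC f) !(BC g) !semi_innerBl// (BC f g); ring.
Qed.

Lemma semi_norm_distb f g : X f -> X g -> `|N f - N g| <= N (fun y => f y - g y).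
Proof.
move=> Xf Xg.
have T u v : X u -> X v -> N u <= N (fun y => u y - v y) + N v.
  move=> Xu Xv; rewrite [in leLHS](_ : u = fun y => 1 * (u y - v y) + v y).
    by rewrite (le_trans (semi_norm_lin _ (semi_inner_closedB Xu Xv) Xv))// normr1 mul1r.
  by apply/funext => y; ring.
rewrite ler_norml lerBlDr T// andbT lerNl opprB lerBlDr semi_norm_distC// T//.
Qed.

End SemiInner.

(** * The space L^2(0,1) *)

Section L2.
Context {R : realType}.
Implicit Types (f g h : R -> R) (a x : R).
Notation mu01 := (@mu01 R).

Lemma mu01_setT : (mu01 setT = 1)%E.
Proof.
rewrite /mu01/= /mrestr setTI lebesgue_measure_itv/= lte_fin ltr01.
by rewrite sube0.
Qed.

Global Instance mu01_ae_filter : Filter (nbhs (almost_everywhere mu01)).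
Proof. exact: ae_filter_ringOfSetsType. Qed.

Lemma mu01_fin_num : (mu01 setT \is a fin_num)%E.
Proof. by rewrite mu01_setT. Qed.

Lemma L2_measurable f : L2 f -> measurable_fun setT f.
Proof. by rewrite /L2/= !inE => /andP[/[!inE]]. Qed.

Lemma L2_lin a f g : L2 f -> L2 g -> L2 (fun y => a * f y + g y).
Proof.
move=> Lf Lg; have p1 : (1 <= 2%:E :> \bar R)%E by rewrite lee_fin ler1n.
by have [_] := @Lfun_submod_closed _ _ _ mu01 _ p1; exact.
Qed.

Lemma L2_0 : @L2 R (fun=> 0).
Proof.
have p1 : (1 <= 2%:E :> \bar R)%E by rewrite lee_fin ler1n.
by have [] := @Lfun_submod_closed _ _ _ mu01 _ p1.
Qed.

Lemma L2_integrableM f g : L2 f -> L2 g ->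
  mu01.-integrable setT (EFin \o (fun y => f y * g y)).
Proof. by move=> Lf Lg; apply/Lfun1_integrable/Lfun2_mul_Lfun1. Qed.

Lemma L2_integrable f : L2 f -> mu01.-integrable setT (EFin \o f).
Proof. by move=> Lf; apply/Lfun1_integrable/(Lfun_subset12 mu01_fin_num). Qed.

Lemma L2_bounded f M : measurable_fun setT f -> (forall y, `|f y| <= M) -> L2 f.
Proof.
move=> mf fM; rewrite /L2/= inE/=; apply/andP; split; rewrite inE//=.
rewrite /finite_norm unlock/= poweR_lty//.
apply: (@le_lt_trans _ _ (\int[mu01]_x (M `^ 2)%:E)%E).
  apply: ge0_le_integral => //.
  - apply/measurable_EFinP; apply: (measurableT_comp (measurable_powR _)) => //.
    exact: measurableT_comp.
  - move=> y _; rewrite lee_fin ge0_ler_powR ?nnegrE//.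
    exact: le_trans (fM y).
by rewrite integral_cst//= mu01_setT mule1 ltry.
Qed.

Lemma L2ipC f g : L2ip f g = L2ip g f.
Proof. by apply: eq_Rintegral => y _; rewrite mulrC. Qed.

Lemma L2ip_lin a f g h : L2 f -> L2 g -> L2 h ->
  L2ip (fun y => a * f y + g y) h = a * L2ip f h + L2ip g h.
Proof.
move=> Lf Lg Lh; rewrite /L2ip.
under eq_Rintegral do rewrite mulrDl -mulrA.
rewrite RintegralD//.
- by rewrite RintegralZl//; exact: L2_integrableM.
- rewrite (_ : EFin \o _ = fun y => (a%:E * (f y * h y)%:E)%E); last first.
    by apply/funext => y /=; rewrite EFinM.
  by apply: integrableZl => //; exact: L2_integrableM.
- exact: L2_integrableM.
Qed.

Lemma L2ip_ge0 f : 0 <= L2ip f f.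
Proof. by apply: Rintegral_ge0 => y _; rewrite -expr2 sqr_ge0. Qed.

Lemma semi_inner_L2 : @semi_inner R L2 L2ip.
Proof.
split; [exact: L2_0|exact: L2_lin|exact: L2ip_lin|exact: L2ipC|].
by move=> f _; exact: L2ip_ge0.
Qed.

(** True without [L2 f]: if the integral of f^2 is infinite, [fine] sends both sides to 0.
    Nonnegativity and the formula for the square therefore hold for every f. *)
Lemma L2normE f : L2norm f = Num.sqrt (L2ip f f).
Proof.
rewrite /L2norm unlock /L2ip /Rintegral.
under [in RHS]eq_integral do rewrite -expr2.
have -> : (\int[mu01]_x (`|(EFin \o f) x| `^ 2) = \int[mu01]_x (f x ^+ 2)%:E)%E.
  apply: eq_integral => x _.
  by rewrite /= powR_mulrn// -normrX ger0_norm// sqr_ge0.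
have : (0 <= \int[mu01]_x (f x ^+ 2)%:E)%E.
  by apply: integral_ge0 => x _; rewrite lee_fin sqr_ge0.
case: (\int[_]_x _)%E => [r|_|//] /=.
  by rewrite lee_fin => r0; rewrite powR12_sqrt.
by rewrite invr_eq0 pnatr_eq0/= sqrtr0.
Qed.

Lemma L2norm_ge0 f : 0 <= L2norm f.
Proof. by rewrite L2normE sqrtr_ge0. Qed.

Lemma L2norm_sqr f : L2norm f ^+ 2 = L2ip f f.
Proof. by rewrite L2normE sqr_sqrtr// L2ip_ge0. Qed.

Lemma L2ip_CS f g : L2 f -> L2 g -> `|L2ip f g| <= L2norm f * L2norm g.
Proof. by rewrite !L2normE; exact: semi_inner_CS semi_inner_L2 _ _. Qed.

Lemma L2ip_ae f g h : L2 f -> L2 g -> L2 h -> f = g %[ae mu01] ->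
  L2ip f h = L2ip g h.
Proof.
move=> /L2_measurable mf /L2_measurable mg /L2_measurable mh fg.
rewrite /L2ip /Rintegral; congr fine; apply: ae_eq_integral => //.
- by apply/measurable_EFinP; exact: measurable_funM.
- by apply/measurable_EFinP; exact: measurable_funM.
- by apply: filterS fg => y /= /(_ Logic.I) -> _.
Qed.

Lemma L2norm_ae f g : L2 f -> L2 g -> f = g %[ae mu01] -> L2norm f = L2norm g.
Proof.
move=> Lf Lg fg; rewrite !L2normE; congr Num.sqrt.
by rewrite (L2ip_ae Lf Lg Lf fg) L2ipC (L2ip_ae Lf Lg Lg fg).
Qed.

End L2.

(** * Functions orthogonal to all test functions *)

Section WeakDerivative.
Context {R : realType}.
Implicit Types (f g h u v phi : R -> R) (a b x : R).
Notation mu01 := (@mu01 R).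
Notation mu := (@lebesgue_measure R).

Lemma integral01_oo (f : R -> \bar R) :
  (\int[mu01]_(x in `]0%R, 1%R[) f x = \int[mu]_(x in `]0%R, 1%R[) f x)%E.
Proof.
by apply: eq_measure_integral => A mA AD; rewrite /mu01/= /mrestr setIidl.
Qed.

Lemma mu01_ae (P : R -> Prop) : {ae mu, forall x, 0 < x < 1 -> P x} ->
  {ae mu01, forall x, P x}.
Proof.
move=> [N [mN N0 subN]].
exists (N `|` ~` [set` `]0, 1[]); split.
- by apply: measurableU => //; exact: measurableC.
- rewrite /mu01/= /mrestr; apply/eqP; rewrite eq_le measure_ge0 andbT -N0.
  apply: le_measure; rewrite ?inE//.
    by apply: measurableI => //; apply: measurableU => //; exact: measurableC.
  by move=> x [[//|/= nx]] /=.
- move=> x /= nPx; have [x01|] := boolP (0 < x < 1); last first.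
    by move=> nx; right; rewrite /= in_itv/=; exact/negP.
  by left; apply: subN => /= /(_ x01).
Qed.

Lemma L2_lebesgue_integrable g : L2 g -> mu.-integrable `]0, 1[ (EFin \o g).
Proof.
move=> /L2_integrable /integrableP[mg gfin]; apply/integrableP; split.
  exact: measurable_funS mg.
rewrite -integral01_oo; apply: le_lt_trans gfin.
apply: ge0_subset_integral => //.
by apply: measurableT_comp.
Qed.

Lemma test_fun_L2 phi : test_fun phi -> L2 phi.
Proof.
move=> tphi; have cphi := test_fun_continuous tphi.
have [_ [a [b [a0 b1 phi0]]]] := tphi.
have cphi' : {within `[(0 : R), 1], continuous (fun x => `|phi x|)}.
  apply: continuous_within => x _; apply: (@continuous_comp _ _ _ phi Num.norm).
    exact: cphi.
  exact: norm_continuous.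
have [c _ cmax] := EVT_max ler01 cphi'.
apply: (@L2_bounded _ _ `|phi c|); first exact: continuous_measurable_fun.
move=> y; have [y01|y01] := boolP (y \in `[0, 1]); first exact: cmax.
rewrite phi0 ?normr0//; apply: contra y01; rewrite !in_itv/= => /andP[ay yb].
by rewrite (le_trans (ltW a0) ay) (le_trans yb (ltW b1)).
Qed.

(** Dominated convergence: the bumps tend pointwise to the indicator of ]a, b[, and the products
    with g stay below |g|. *)
Lemma L2_test_orthogonal_itv g : L2 g ->
  (forall phi, test_fun phi -> L2ip g phi = 0) ->
  forall a b, 0 < a -> b < 1 -> \int[mu]_(x in `]a, b[) g x = 0.
Proof.
move=> Lg g0 a b a0 b1.
pose f_ (n : nat) x := (g x * bump a b n.+1%:R x)%:E.
pose f x := (g x * \1_`]a, b[ x)%:E.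
have mg := L2_measurable Lg.
have cvgI : (\int[mu01]_x f_ n x @[n --> \oo] --> \int[mu01]_x f x)%E.
  apply: (@dominated_cvg _ _ _ mu01 _ _ _ _ (fun x => `|g x|%:E)) => //.
  - move=> n; apply/measurable_EFinP; apply: measurable_funM => //.
    apply: continuous_measurable_fun => x.
    exact: is_derive_cvg (ndiff_is_derive x (bump_ndiff 1 a b n.+1%:R)).
  - move=> x _; apply: cvg_EFin; first exact: nearW.
    apply: cvgMr; rewrite indicE mem_setE in_itv/=.
    have [xab|xab] := boolP (a < x < b); first exact: bump_cvg.
    rewrite (_ : (fun _ => _) = cst 0); first exact: cvg_cst.
    by apply/funext => n; rewrite bump_eq0.
  - have := integrable_abse (L2_integrable Lg).
    by apply: eq_integrable.
  - move=> n x _; rewrite lee_fin normrM ler_piMr//.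
    by rewrite ger0_norm ?bump_ge0// bump_le1.
have f0 : (\int[mu01]_x f x = 0)%E.
  have : (\int[mu01]_x f_ n x @[n --> \oo] --> 0)%E.
    rewrite (_ : (fun _ => _) = cst 0%E); first exact: cvg_cst.
    apply/funext => n; have t0 : 0 < n.+1%:R :> R by [].
    have tb := test_fun_bump t0 a0 b1.
    have := g0 _ tb; rewrite /L2ip /Rintegral => /eqP; rewrite fine_eq0.
      by move/eqP.
    by apply: integrable_fin_num => //; exact: (L2_integrableM Lg (test_fun_L2 tb)).
  by move=> /(cvg_unique _ cvgI); apply.
rewrite /Rintegral; apply/eqP; rewrite -[X in _ == X]/(fine 0%E); apply/eqP; congr fine.
rewrite -f0 [LHS]integral_mkcond.
transitivity (\int[mu]_(x in `]0%R, 1%R[) f x)%E; last first.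
  rewrite -integral01_oo [LHS]integral_mkcond; apply: eq_integral => x _.
  rewrite patchE; case: ifPn => //; rewrite mem_setE in_itv/= => nx.
  rewrite /f indicE mem_setE in_itv/=.
  case: (boolP (a < x < b)) => [/andP[ax xb]|_]; last by rewrite mulr0.
  case/negP: nx.
  by rewrite (lt_trans a0 ax) (lt_trans xb b1).
rewrite [RHS]integral_mkcond; apply: eq_integral => x _.
rewrite !patchE !mem_setE !in_itv/= /f indicE mem_setE in_itv/=.
case: (boolP (a < x < b)) => [/andP[ax xb]|_]; last by rewrite mulr0 if_same.
by rewrite (lt_trans a0 ax) (lt_trans xb b1) mulr1.
Qed.

(** By Lebesgue differentiation g is almost everywhere the derivative of its primitive, and the
    primitive is constant on ]0, 1[ because the integrals over inner intervals vanish. *)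
Lemma L2_test_orthogonal g : L2 g ->
  (forall phi, test_fun phi -> L2ip g phi = 0) -> g = (fun=> 0) %[ae mu01].
Proof.
move=> Lg g0; have itv0 := L2_test_orthogonal_itv Lg g0.
(* Outside ]0, 1[ the representative g is arbitrary, so it is cut off before the differentiation
   theorem on the whole line is applied. *)
pose gg := g \_ `]0, 1[.
have igg (D : set R) : measurable D -> mu.-integrable D (EFin \o gg).
  move=> mD; apply: (@integrableS _ _ _ _ setT) => //.
  rewrite /gg -restrict_EFin; apply: (proj1 (integrable_mkcond _ _)) => //.
  exact: L2_lebesgue_integrable.
have lgg : locally_integrable [set: R] gg.
  by apply: integrable_locally => //; exact: L2_lebesgue_integrable.
have FTC := @FTC1 R gg (BLeft 0) (fun y => igg _ (measurable_itv _)) lgg.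
suff : {ae mu, forall x, 0 < x < 1 -> g x = 0} by move/mu01_ae; apply: filterS => x -> _.
have FF : Filter (nbhs (almost_everywhere mu)) by exact: ae_filter_ringOfSetsType.
apply: filterS FTC => x H x01; case/andP: (x01) => x0 x1.
move: H; rewrite /= lte_fin => /(_ x0)[dF F'].
have <- : gg x = g x by rewrite /gg patchE ifT// mem_setE in_itv/= x0.
rewrite -F'; apply: is_derive_derive1.
set F := (F in is_derive _ _ F _).
apply: (@near_is_derive _ (cst (F x)) _ 0 1) => //.
have W y z : 0 < y -> y < z -> z < 1 -> F z = F y.
  move=> y0 yz z1; apply/eqP; rewrite -subr_eq0 /F.
  rewrite Rintegral_itvB; last 3 first.
  - exact: (igg _ (measurable_itv _)).
  - by rewrite bnd_simp ltW.
  - by rewrite bnd_simp ltW.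
  rewrite -Rintegral_itv_bndo_bndc; last exact: (igg _ (measurable_itv _)).
  rewrite -(itv0 y z)//; apply/eqP; apply: eq_Rintegral => t.
  rewrite mem_setE in_itv/= => /andP[yt tz].
  by rewrite /gg patchE ifT// mem_setE in_itv/= (lt_trans y0 yt) (lt_trans tz z1).
move=> y y0 y1 /=; have [xy|yx|->//] := ltgtP x y; first by rewrite -(W x y).
exact: W.
Qed.

End WeakDerivative.

(** * Weak derivatives and the spaces H^1 and H_0^1 *)

Section H1space.
Context {R : realType}.
Implicit Types (f g h u v phi psi : R -> R) (a b x : R).
Notation mu01 := (@mu01 R).

Lemma wderivP u : H1 u -> is_wderiv u (wderiv u).
Proof. by move=> [_ [g ug]]; apply: (@xgetPex _ (cst 0) [set g | is_wderiv u g]); exists g. Qed.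

Lemma wderiv_L2 u : H1 u -> L2 (wderiv u).
Proof. by move/wderivP => []. Qed.

Lemma H1_L2 u : H1 u -> L2 u.
Proof. by case. Qed.

(** The source of every algebraic rule for [wderiv]: the chosen derivative of a combination and the
    combination of the chosen derivatives are both weak derivatives of the same function. *)
Lemma is_wderiv_ae u g h : is_wderiv u g -> is_wderiv u h -> g = h %[ae mu01].
Proof.
move=> [Lg ug] [Lh uh].
have LB := semi_inner_closedB semi_inner_L2 Lg Lh.
have : (fun y => g y - h y) = (fun=> 0) %[ae mu01].
  apply: (L2_test_orthogonal LB) => phi tphi.
  rewrite (semi_innerBl semi_inner_L2)//; last exact: test_fun_L2.
  by apply/eqP; rewrite subr_eq0 -eqr_opp -ug// -uh.
apply: filterS => y /[apply] /eqP.
by rewrite subr_eq0 => /eqP.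
Qed.

Lemma is_wderiv_lin a u v g h : L2 u -> L2 v -> is_wderiv u g -> is_wderiv v h ->
  is_wderiv (fun y => a * u y + v y) (fun y => a * g y + h y).
Proof.
move=> Lu Lv [Lg ug] [Lh vh]; split; first exact: L2_lin.
move=> phi tphi; have L1 := test_fun_L2 tphi.
have L2' := test_fun_L2 (test_fun_derive1 tphi).
by rewrite (L2ip_lin a Lu Lv L2') (L2ip_lin a Lg Lh L1) ug// vh// opprD mulrN.
Qed.

Lemma H1_lin a u v : H1 u -> H1 v -> H1 (fun y => a * u y + v y).
Proof.
move=> Hu Hv; have [Lu _] := Hu; have [Lv _] := Hv.
split; first exact: L2_lin.
exists (fun y => a * wderiv u y + wderiv v y).
by apply: is_wderiv_lin => //; exact: wderivP.
Qed.

Lemma wderiv_lin a u v : H1 u -> H1 v ->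
  wderiv (fun y => a * u y + v y) = (fun y => a * wderiv u y + wderiv v y) %[ae mu01].
Proof.
move=> Hu Hv; apply: is_wderiv_ae; first exact/wderivP/H1_lin.
by apply: is_wderiv_lin (H1_L2 Hu) (H1_L2 Hv) _ _; exact: wderivP.
Qed.

Lemma is_wderiv_test_fun phi : test_fun phi -> is_wderiv phi (derive1 phi).
Proof.
move=> tphi; split; first exact/test_fun_L2/test_fun_derive1.
move=> psi tpsi; apply: Rintegral_by_parts01 => // x _.
  exact: test_fun_is_derive.
exact/test_fun_continuous/test_fun_derive1.
Qed.

Lemma test_fun_H1 phi : test_fun phi -> H1 phi.
Proof.
move=> tphi; split; first exact: test_fun_L2.
by exists (derive1 phi); exact: is_wderiv_test_fun.
Qed.

Lemma test_fun0 : test_fun (fun=> 0 : R).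
Proof.
rewrite (_ : (fun=> 0) = fun x => -1 * bump (1 / 3) (2 / 3) 1 x + bump (1 / 3) (2 / 3) (1 : R) x).
  by apply: test_fun_lin; apply: test_fun_bump; lra.
by apply/funext => x; ring.
Qed.

Definition H1ip u v : R := L2ip u v + L2ip (wderiv u) (wderiv v).

Lemma semi_inner_H1 : semi_inner H1 H1ip.
Proof.
split.
- exact/test_fun_H1/test_fun0.
- exact: H1_lin.
- move=> a f g h Hf Hg Hh; rewrite /H1ip.
  have Lf := wderiv_L2 Hf; have Lg := wderiv_L2 Hg; have Lh := wderiv_L2 Hh.
  have Lw := wderiv_L2 (H1_lin a Hf Hg).
  rewrite (L2ip_ae Lw (L2_lin a Lf Lg) Lh (wderiv_lin a Hf Hg)).
  rewrite (L2ip_lin a (H1_L2 Hf) (H1_L2 Hg) (H1_L2 Hh)) (L2ip_lin a Lf Lg Lh).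
  by rewrite mulrDr addrACA.
- by move=> f g; rewrite /H1ip !(L2ipC f) !(L2ipC (wderiv f)).
- by move=> f _; rewrite addr_ge0// L2ip_ge0.
Qed.

Lemma H1normE u : H1norm u = Num.sqrt (H1ip u u).
Proof. by rewrite /H1norm !L2norm_sqr. Qed.

Lemma H1norm_sqr u : H1norm u ^+ 2 = L2norm u ^+ 2 + L2norm (wderiv u) ^+ 2.
Proof. by rewrite sqr_sqrtr// addr_ge0// sqr_ge0. Qed.

Lemma H1norm_ge0 u : 0 <= H1norm u.
Proof. exact: sqrtr_ge0. Qed.

Lemma L2norm_le_H1norm u : L2norm u <= H1norm u.
Proof.
rewrite -(@ler_pXn2r _ 2) ?nnegrE ?H1norm_ge0 ?L2norm_ge0//.
by rewrite H1norm_sqr lerDl sqr_ge0.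
Qed.

Lemma L2norm_wderiv_le_H1norm u : L2norm (wderiv u) <= H1norm u.
Proof.
rewrite -(@ler_pXn2r _ 2) ?nnegrE ?H1norm_ge0 ?L2norm_ge0//.
by rewrite H1norm_sqr lerDr sqr_ge0.
Qed.

Lemma H1_subr u v : H1 u -> H1 v -> H1 (fun y => u y - v y).
Proof. exact: semi_inner_closedB semi_inner_H1 _ _. Qed.

Lemma L2_subr u v : L2 u -> L2 v -> L2 (fun y => u y - v y).
Proof. exact: semi_inner_closedB semi_inner_L2 _ _. Qed.

Lemma wderivB u v : H1 u -> H1 v ->
  wderiv (fun y => u y - v y) = (fun y => wderiv u y - wderiv v y) %[ae mu01].
Proof.
move=> Hu Hv; rewrite (_ : (fun y => u y - v y) = fun y => -1 * v y + u y).
  apply: filterS (wderiv_lin (-1) Hv Hu) => y /[apply] ->.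
  by rewrite mulN1r addrC.
by apply/funext => y; ring.
Qed.

Lemma L2ip0l f : L2ip (fun=> 0) f = 0.
Proof.
rewrite /L2ip /Rintegral (eq_integral (cst 0%E)) ?integral0// => y _.
by rewrite mul0r.
Qed.

(** Needed at x = 0, where two solutions with the same initial datum agree only almost everywhere in
    y. *)
Lemma H1norm_ae0 u : H1 u -> u = (fun=> 0) %[ae mu01] -> H1norm u = 0.
Proof.
move=> Hu u0; have Lu := H1_L2 Hu; have L0 := @L2_0 R.
have n0 : L2norm (fun=> 0 : R) = 0 by rewrite L2normE; exact: semi_norm0 semi_inner_L2.
have w0 : is_wderiv u (fun=> 0).
  split=> // phi tphi; have Lp := test_fun_L2 tphi.
  by rewrite (L2ip_ae Lu L0 (test_fun_L2 (test_fun_derive1 tphi)) u0) !L2ip0l oppr0.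
rewrite /H1norm (L2norm_ae Lu L0 u0) (L2norm_ae (wderiv_L2 Hu) L0 (is_wderiv_ae (wderivP Hu) w0)).
by rewrite !n0 expr0n addr0 sqrtr0.
Qed.

Lemma H10_H1 u : H10 u -> H1 u.
Proof. by case. Qed.

Lemma H10_lin a u v : H10 u -> H10 v -> H10 (fun y => a * u y + v y).
Proof.
move=> [Hu ucl] [Hv vcl]; split; first exact: H1_lin.
move=> e e0; have a0 : 0 < `|a| + 1 by rewrite ltr_wpDl.
have [phi [tphi uphi]] : exists phi, test_fun phi /\ H1norm (fun y => u y - phi y) < e / 2 / (`|a| + 1).
  by apply: ucl; rewrite !divr_gt0.
have [psi [tpsi vpsi]] : exists phi, test_fun phi /\ H1norm (fun y => v y - phi y) < e / 2.
  by apply: vcl; rewrite divr_gt0.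
exists (fun y => a * phi y + psi y); split; first exact: test_fun_lin.
rewrite (_ : (fun _ => _) = fun y => a * (u y - phi y) + (v y - psi y)); last first.
  by apply/funext => y; ring.
rewrite (le_lt_trans (y := `|a| * H1norm (fun y => u y - phi y) + H1norm (fun y => v y - psi y)))//.
  rewrite !H1normE; apply: (semi_norm_lin semi_inner_H1); apply: H1_subr => //; exact: test_fun_H1.
rewrite [ltRHS]splitr ler_ltD//.
move: uphi; rewrite ltr_pdivlMr// => /ltW; apply: le_trans.
by rewrite mulrC ler_wpM2l ?H1norm_ge0// lerDl.
Qed.

Lemma H10_subr u v : H10 u -> H10 v -> H10 (fun y => u y - v y).
Proof.
move=> Hu Hv; rewrite (_ : (fun _ => _) = fun y => -1 * v y + u y); first exact: H10_lin.
by apply/funext => y; ring.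
Qed.

End H1space.

(** * Curves in L^2 and H^1 *)

Section Curves.
Context {R : realType}.
Implicit Types (f g psi : R -> R) (x T e d : R) (u v w : R -> R -> R).
Implicit Types (X : set (R -> R)) (N : (R -> R) -> R) (B : (R -> R) -> (R -> R) -> R).

Lemma cvg_within_eps (D : set R) (F : R -> R) (l x : R) :
  (F s @[s --> within D (nbhs x)] --> l) <->
  forall e, 0 < e -> exists2 d, 0 < d & forall s, D s -> `|s - x| < d -> `|F s - l| <= e.
Proof.
split=> [/cvgrPdist_le H e e0|H].
  have [d /= d0 Hd] := H _ e0; exists d => // s Ds sx.
  by rewrite distrC; apply: Hd => //; rewrite /= distrC.
apply/cvgrPdist_le => e /H[d d0 Hd]; exists d => // s /=; rewrite distrC => sx Ds.
by rewrite distrC; exact: Hd.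
Qed.

Lemma cvg_within_dnbhs_eps (D : set R) (F : R -> R) (l x : R) :
  (F s @[s --> within D x^'] --> l) <->
  forall e, 0 < e -> exists2 d, 0 < d &
    forall s, D s -> s != x -> `|s - x| < d -> `|F s - l| <= e.
Proof.
split=> [/cvgrPdist_le H e e0|H].
  have [d /= d0 Hd] := H _ e0; exists d => // s Ds sx0 sx.
  by rewrite distrC; apply: Hd => //; rewrite /= distrC.
apply/cvgrPdist_le => e /H[d d0 Hd]; exists d => // s /=; rewrite distrC => sx s0 Ds.
by rewrite distrC; exact: Hd.
Qed.

Lemma contin_eps X N T u : contin X N T u <->
  (forall x, 0 <= x <= T -> X (u x)) /\
  (forall x, 0 <= x <= T -> forall e, 0 < e -> exists2 d, 0 < d & forall s,
     0 <= s <= T -> `|s - x| < d -> `|N (fun y => u s y - u x y)| <= e).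
Proof.
split=> -[H1 H2]; split=> x xT.
- by apply: H1; rewrite in_itv.
- have := H2 x; rewrite in_itv/= => /(_ xT) H.
  move=> e e0; have [d d0 Hd] := (cvg_within_eps _ _ _ _).1 H _ e0; exists d => // s sT sx.
  by rewrite -[X in `|X|]subr0; apply: Hd => //=; rewrite in_itv.
- by apply: H1; rewrite in_itv/= in xT.
- apply/cvg_within_eps => e e0; rewrite in_itv/= in xT.
  have [d d0 Hd] := H2 _ xT _ e0; exists d => // s /=; rewrite in_itv/= => sT sx.
  by rewrite subr0; exact: Hd.
Qed.

Lemma is_dx_eps T u w : is_dx T u w <->
  (forall x, 0 <= x <= T -> L2 (u x) /\ L2 (w x)) /\
  (forall x, 0 <= x <= T -> forall e, 0 < e -> exists2 d, 0 < d & forall s,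
     0 <= s <= T -> s != x -> `|s - x| < d ->
     L2norm (fun y => (u s y - u x y) / (s - x) - w x y) <= e).
Proof.
split=> -[H1 H2]; split=> x xT.
- by apply: H1; rewrite in_itv.
- have := H2 x; rewrite in_itv/= => /(_ xT) H.
  move=> e e0; have [d d0 Hd] := (cvg_within_dnbhs_eps _ _ _ _).1 H _ e0.
  exists d => // s sT sx0 sx; rewrite -[leLHS]ger0_norm ?L2norm_ge0//.
  by rewrite -[X in `|X|]subr0; apply: Hd => //=; rewrite in_itv.
- by apply: H1; rewrite in_itv/= in xT.
- apply/cvg_within_dnbhs_eps => e e0; rewrite in_itv/= in xT.
  have [d d0 Hd] := H2 _ xT _ e0; exists d => // s /=; rewrite in_itv/= => sT sx0 sx.
  by rewrite subr0 ger0_norm ?L2norm_ge0//; exact: Hd.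
Qed.

Lemma contin_restrict X N T T' u : T' <= T -> contin X N T u -> contin X N T' u.
Proof.
move=> TT /contin_eps[H1 H2]; apply/contin_eps.
have W x : 0 <= x <= T' -> 0 <= x <= T by move=> /andP[-> /le_trans]; exact.
split=> x /W xT; first exact: H1.
move=> e /(H2 _ xT)[d d0 Hd]; exists d => // s /W; exact: Hd.
Qed.

Lemma is_dx_restrict T T' u w : T' <= T -> is_dx T u w -> is_dx T' u w.
Proof.
move=> TT /is_dx_eps[H1 H2]; apply/is_dx_eps.
have W x : 0 <= x <= T' -> 0 <= x <= T by move=> /andP[-> /le_trans]; exact.
split=> x /W xT; first exact: H1.
move=> e /(H2 _ xT)[d d0 Hd]; exists d => // s /W; exact: Hd.
Qed.

Section SemiNormCurves.
Context X N B (HB : semi_inner X B) (NE : forall f, N f = Num.sqrt (B f f)).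

Let N_ge0 f : 0 <= N f. Proof. by rewrite NE sqrtr_ge0. Qed.

Lemma contin_subr T u v : contin X N T u -> contin X N T v ->
  contin X N T (fun x y => u x y - v x y).
Proof.
move=> /contin_eps[u1 u2] /contin_eps[v1 v2]; apply/contin_eps; split=> x xT.
  exact: (semi_inner_closedB HB (u1 _ xT) (v1 _ xT)).
move=> e e0; have e2 : 0 < e / 2 by rewrite divr_gt0.
have [d1 d10 D1] := u2 _ xT _ e2; have [d2 d20 D2] := v2 _ xT _ e2.
exists (Num.min d1 d2); first by rewrite lt_min d10.
move=> s sT; rewrite lt_min => /andP[/(D1 _ sT) s1 /(D2 _ sT) s2].
rewrite (_ : (fun _ => _) = fun y => (u s y - u x y) - (v s y - v x y)); last first.
  by apply/funext => y; ring.
rewrite ger0_norm// in s1; rewrite ger0_norm// in s2; rewrite ger0_norm//.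
rewrite NE in s1; rewrite NE in s2.
rewrite NE (le_trans (semi_normB HB _ _))//; last by rewrite [leRHS]splitr lerD.
- exact: (semi_inner_closedB HB (u1 _ sT) (u1 _ xT)).
- exact: (semi_inner_closedB HB (v1 _ sT) (v1 _ xT)).
Qed.

Lemma contin_norm T u : contin X N T u ->
  {within `[(0 : R), T], continuous (fun x => N (u x))}.
Proof.
move=> /contin_eps[u1 u2]; apply/subspace_continuousP => x /=; rewrite in_itv/= => xT.
apply/cvg_within_eps => e e0; have [d d0 Hd] := u2 _ xT _ e0.
exists d => // s /=; rewrite in_itv/= => sT sx.
have := Hd _ sT sx; rewrite ger0_norm//; apply: le_trans.
by rewrite /from_subspace !NE; exact: (semi_norm_distb HB (u1 _ sT) (u1 _ xT)).
Qed.

Lemma contin_norm_bounded T u : contin X N T u ->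
  exists M, forall x, 0 <= x <= T -> N (u x) <= M.
Proof.
move=> cu; have [T0|T0] := leP 0 T; last first.
  by exists 0 => x /andP[x0 xT]; have := le_lt_trans (le_trans x0 xT) T0; rewrite ltxx.
have [c _ cmax] := EVT_max T0 (contin_norm cu).
by exists (N (u c)) => x xT; apply: cmax; rewrite in_itv.
Qed.

End SemiNormCurves.

Lemma L2_contin_subr T u v : contin L2 L2norm T u -> contin L2 L2norm T v ->
  contin L2 L2norm T (fun x y => u x y - v x y).
Proof. exact: (contin_subr semi_inner_L2 L2normE). Qed.

Lemma H1_contin_subr T u v : contin H1 H1norm T u -> contin H1 H1norm T v ->
  contin H1 H1norm T (fun x y => u x y - v x y).
Proof. exact: (contin_subr semi_inner_H1 H1normE). Qed.

Lemma H1_contin_L2 T u : contin H1 H1norm T u -> contin L2 L2norm T u.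
Proof.
move=> /contin_eps[u1 u2]; apply/contin_eps; split=> x xT; first exact/H1_L2/u1.
move=> e /(u2 _ xT)[d d0 Hd]; exists d => // s sT sx.
have := Hd _ sT sx; rewrite !ger0_norm ?L2norm_ge0 ?H1norm_ge0//.
exact/le_trans/L2norm_le_H1norm.
Qed.

Lemma H1_contin_wderiv T u : contin H1 H1norm T u ->
  contin L2 L2norm T (fun x => wderiv (u x)).
Proof.
move=> /contin_eps[u1 u2]; apply/contin_eps; split=> x xT; first exact/wderiv_L2/u1.
move=> e /(u2 _ xT)[d d0 Hd]; exists d => // s sT sx.
have := Hd _ sT sx; rewrite !ger0_norm ?L2norm_ge0 ?H1norm_ge0//.
have Hs := u1 _ sT; have Hx := u1 _ xT.
rewrite -(L2norm_ae _ _ (wderivB Hs Hx)); first exact/le_trans/L2norm_wderiv_le_H1norm.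
- exact/wderiv_L2/H1_subr.
- by apply: L2_subr; exact: wderiv_L2.
Qed.

Lemma L2norm_le_near f g : L2 f -> L2 g -> L2norm f <= L2norm (fun y => f y - g y) + L2norm g.
Proof.
move=> Lf Lg; have := semi_norm_distb semi_inner_L2 Lf Lg.
by rewrite -!L2normE => /(le_trans (ler_norm _)); rewrite lerBlDr.
Qed.

Lemma cont2_L2ip u v : contin L2 L2norm 1 u -> contin L2 L2norm 1 v ->
  cont2 [set x | 0 < x < 1] (fun r s => L2ip (u r) (v s)).
Proof.
have W (x : R) : 0 < x < 1 -> 0 <= x <= 1 by move=> /andP[/ltW -> /ltW ->].
move=> /contin_eps[u1 u2] /contin_eps[v1 v2] r s /W rI /W sI e e0.
(* The 1 in M, together with e1 <= 1, absorbs the bound ||v(s')|| <= ||v(s)|| + 1 at the moving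
   point s'. *)
pose M := L2norm (u r) + L2norm (v s) + 1.
have M0 : 0 < M by rewrite ltr_wpDl// addr_ge0// L2norm_ge0.
pose e1 := Num.min 1 (e / 2 / M).
have e10 : 0 < e1 by rewrite lt_min ltr01 !divr_gt0.
have [d1 d10 D1] := u2 _ rI _ e10; have [d2 d20 D2] := v2 _ sI _ e10.
exists (Num.min d1 d2); first by rewrite lt_min d10.
move=> r' s' /= /W r'I /W s'I; rewrite !lt_min => /andP[rd _] /andP[_ sd].
have := D1 _ r'I rd; rewrite ger0_norm ?L2norm_ge0// => B1.
have := D2 _ s'I sd; rewrite ger0_norm ?L2norm_ge0// => B2.
have e1M : e1 * M <= e / 2 by rewrite -ler_pdivlMr// ge_min lexx orbT.
have e11 : e1 <= 1 by rewrite ge_min lexx.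
have Lr := u1 _ rI; have Lr' := u1 _ r'I; have Ls := v1 _ sI; have Ls' := v1 _ s'I.
have Lrr := L2_subr Lr' Lr; have Lss := L2_subr Ls' Ls.
have -> : L2ip (u r') (v s') - L2ip (u r) (v s) =
    L2ip (fun y => u r' y - u r y) (v s') + L2ip (fun y => v s' y - v s y) (u r).
  rewrite (semi_innerBl semi_inner_L2 Lr' Lr Ls') (semi_innerBl semi_inner_L2 Ls' Ls Lr).
  by rewrite (L2ipC (u r)) (L2ipC (v s')) (L2ipC (v s)) addrA subrK.
rewrite (le_trans (ler_normD _ _))// [leRHS]splitr lerD//.
  rewrite (le_trans (L2ip_CS Lrr Ls'))// (le_trans _ e1M)// ler_pM ?L2norm_ge0//.
  rewrite (le_trans (L2norm_le_near Ls' Ls))// /M addrC.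
  rewrite (le_trans (lerD (lexx _) (le_trans B2 e11)))// lerD2r lerDr L2norm_ge0//.
rewrite (le_trans (L2ip_CS Lss Lr))// (le_trans _ e1M)// ler_pM ?L2norm_ge0//.
by rewrite /M -addrA lerDl addr_ge0// L2norm_ge0.
Qed.

Lemma contin_L2ip u psi : contin L2 L2norm 1 u -> L2 psi ->
  {within `[(0 : R), 1], continuous (fun x => L2ip (u x) psi)}.
Proof.
move=> /contin_eps[u1 u2] Lp; apply/subspace_continuousP => x /=; rewrite in_itv/= => xT.
apply/cvg_within_eps => e e0; have M0 : 0 < L2norm psi + 1 by rewrite ltr_wpDl// L2norm_ge0.
have [|d d0 Hd] := u2 _ xT (e / (L2norm psi + 1)); first by rewrite divr_gt0.
exists d => // s /=; rewrite in_itv/= => sT sx.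
have Ls := u1 _ sT; have Lx := u1 _ xT.
rewrite /from_subspace -(semi_innerBl semi_inner_L2 Ls Lx Lp) (le_trans (L2ip_CS (L2_subr Ls Lx) Lp))//.
have := Hd _ sT sx; rewrite ger0_norm ?L2norm_ge0// ler_pdivlMr//; apply: le_trans.
by rewrite ler_wpM2l ?L2norm_ge0// lerDl.
Qed.

(** Pairing with a fixed psi lets real one-variable calculus act on curves in L^2; the remainder is
    bounded by Cauchy-Schwarz. *)
Lemma is_dx_is_derive T u w psi x : is_dx T u w -> L2 psi -> 0 < x < T ->
  is_derive x 1 (fun x => L2ip (u x) psi) (L2ip (w x) psi).
Proof.
move=> /is_dx_eps[H1 H2] Lp /andP[x0 xT].
have xI : 0 <= x <= T by rewrite !ltW.
apply/is_derive1P => e e0; have M0 : 0 < L2norm psi + 1 by rewrite ltr_wpDl// L2norm_ge0.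
have [|d d0 Hd] := H2 _ xI (e / (L2norm psi + 1)); first by rewrite divr_gt0.
exists (Num.min d (Num.min x (T - x))); first by rewrite !lt_min d0 x0 subr_gt0.
move=> s; rewrite !lt_min => /and3P[sd s1 s2].
have [->|sx] := eqVneq s x; first by rewrite !subrr mulr0 subrr !normr0 mulr0.
have sI : 0 <= s <= T.
  by move: s1 s2; clear; rewrite !ltr_norml => /andP[? ?] /andP[? ?]; apply/andP; split; lra.
have [Lx Lw] := H1 _ xI; have [Ls _] := H1 _ sI.
have := Hd _ sI sx sd; rewrite ler_pdivlMr// => B.
have E : (fun y => (u s y - u x y) / (s - x) - w x y) =
         (fun y => (s - x)^-1 * (u s y - u x y) - w x y) by apply/funext => y; rewrite mulrC.
have Lsx := L2_subr Ls Lx.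
have Lq : L2 (fun y => (s - x)^-1 * (u s y - u x y)).
  rewrite (_ : (fun _ => _) = fun y => (s - x)^-1 * (u s y - u x y) + 0).
    exact: (L2_lin _ Lsx L2_0).
  by apply/funext => y; rewrite addr0.
have -> : L2ip (u s) psi - L2ip (u x) psi - L2ip (w x) psi * (s - x) =
    (s - x) * L2ip (fun y => (u s y - u x y) / (s - x) - w x y) psi.
  rewrite E (semi_innerBl semi_inner_L2 Lq Lw Lp) (semi_innerZl semi_inner_L2 _ Lsx Lp).
  rewrite (semi_innerBl semi_inner_L2 Ls Lx Lp).
  move: (L2ip (u s) psi) (L2ip (u x) psi) (L2ip (w x) psi) => p q r.
  by field; rewrite subr_eq0.
rewrite normrM mulrC ler_wpM2r//.
have LE : L2 (fun y => (u s y - u x y) / (s - x) - w x y) by rewrite E; exact: L2_subr.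
rewrite (le_trans (L2ip_CS LE Lp))//; apply: le_trans B.
by rewrite ler_wpM2l ?L2norm_ge0// lerDl.
Qed.

Lemma is_dx_subr T u v w z : is_dx T u w -> is_dx T v z ->
  is_dx T (fun x y => u x y - v x y) (fun x y => w x y - z x y).
Proof.
move=> /is_dx_eps[u1 u2] /is_dx_eps[v1 v2]; apply/is_dx_eps; split=> x xT.
  have [? ?] := u1 _ xT; have [? ?] := v1 _ xT; by split; exact: L2_subr.
move=> e e0; have e2 : 0 < e / 2 by rewrite divr_gt0.
have [d1 d10 D1] := u2 _ xT _ e2; have [d2 d20 D2] := v2 _ xT _ e2.
exists (Num.min d1 d2); first by rewrite lt_min d10.
move=> s sT sx0; rewrite lt_min => /andP[/(D1 _ sT sx0) s1 /(D2 _ sT sx0) s2].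
rewrite (_ : (fun _ => _) = fun y => ((u s y - u x y) / (s - x) - w x y)
   - ((v s y - v x y) / (s - x) - z x y)); last by apply/funext => y; ring.
have Q (a b c : R -> R) : L2 a -> L2 b -> L2 c -> L2 (fun y => (a y - b y) / (s - x) - c y).
  move=> La Lb Lc; rewrite (_ : (fun _ => _) = fun y => (s - x)^-1 * (a y - b y) + (0 - c y)).
    by apply: L2_lin; apply: L2_subr => //; exact: L2_0.
  by apply/funext => y; rewrite sub0r mulrC.
have [us _] := u1 _ sT; have [ux wx] := u1 _ xT; have [vs _] := v1 _ sT; have [vx zx] := v1 _ xT.
rewrite L2normE (le_trans (semi_normB semi_inner_L2 (Q _ _ _ us ux wx) (Q _ _ _ vs vx zx)))//.
by rewrite -!L2normE [leRHS]splitr lerD.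
Qed.

(** [dx] is an arbitrary choice among the derivatives, and [HHnorm] sees it only through these
    norms. Both derivatives are compared with one difference quotient. *)
Lemma is_dx_unique T u w w' x : 0 < T -> is_dx T u w -> is_dx T u w' ->
  0 <= x <= T -> L2norm (w x) = L2norm (w' x).
Proof.
move=> T0 /is_dx_eps[a1 a2] /is_dx_eps[b1 b2] xT.
have [Lx Lw] := a1 _ xT; have [_ Lw'] := b1 _ xT.
apply/eqP; rewrite -subr_eq0 -normr_eq0 eq_le normr_ge0 andbT.
apply: (le_trans (y := L2norm (fun y => w x y - w' x y))).
  by rewrite !L2normE; exact: (semi_norm_distb semi_inner_L2 Lw Lw').
apply/ler_addgt0Pr => e e0; rewrite add0r.
have e2 : 0 < e / 2 by rewrite divr_gt0.
have [d1 d10 D1] := a2 _ xT _ e2; have [d2 d20 D2] := b2 _ xT _ e2.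
have [s [sT sx0 sd1 sd2]] : exists s, [/\ 0 <= s <= T, s != x, `|s - x| < d1 & `|s - x| < d2].
  pose d := Num.min (Num.min d1 d2) T / 2.
  have m0 : 0 < Num.min (Num.min d1 d2) T by rewrite !lt_min d10 d20.
  have d0 : 0 < d by rewrite divr_gt0.
  have : Num.min (Num.min d1 d2) T <= Num.min (Num.min d1 d2) T by [].
  rewrite le_min le_min => /andP[/andP[h1 h2] h3].
  have dd : d + d = Num.min (Num.min d1 d2) T by rewrite -splitr.
  rewrite -dd in h1 h2 h3; case/andP: xT => x0 xT.
  (* As x may be an end point, s is taken on the side of x where at least half of [0, T] remains. *)
  have [xm|xm] := leP x (T / 2).
  - exists (x + d); split; [clear -d0 h3 x0 xm; apply/andP; split; lra|
      by rewrite -subr_eq0 addrC addKr gt_eqF| |];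
      rewrite addrC addKr gtr0_norm//; [clear -h1 d0|clear -h2 d0]; lra.
  - exists (x - d); split; [clear -d0 h3 xT xm; apply/andP; split; lra|
      by rewrite -subr_eq0 addrC addKr oppr_eq0 gt_eqF| |];
      rewrite addrC addKr normrN gtr0_norm//; [clear -h1 d0|clear -h2 d0]; lra.
have [Ls _] := a1 _ sT.
have Q (c : R -> R) : L2 c -> L2 (fun y => (u s y - u x y) / (s - x) - c y).
  move=> Lc; rewrite (_ : (fun _ => _) = fun y => (s - x)^-1 * (u s y - u x y) + (0 - c y)).
    by apply: L2_lin; apply: L2_subr => //; exact: L2_0.
  by apply/funext => y; rewrite sub0r mulrC.
rewrite (_ : (fun _ => _) = fun y => ((u s y - u x y) / (s - x) - w' x y)
   - ((u s y - u x y) / (s - x) - w x y)); last by apply/funext => y; ring.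
rewrite L2normE (le_trans (semi_normB semi_inner_L2 (Q _ Lw') (Q _ Lw)))//.
by rewrite -!L2normE [leRHS]splitr lerD//; [exact: D2|exact: D1].
Qed.

End Curves.

(** * The energy estimate for weak solutions *)

Section Evolution.
Context {R : realType}.
Implicit Types (f psi : R -> R) (x T : R) (g u v w : R -> R -> R).
Notation mu01 := (@mu01 R).

(** A weak solution from which the H^{-1}-valued derivative is eliminated: the tested equation holds
    classically at every interior x. Initial data are kept apart, so that the notion passes to
    differences of solutions with the same datum. *)
Definition evolution v w g : Prop :=
  [/\ (forall x, 0 <= x <= 1 -> H10 (v x)) /\ contin H1 H1norm 1 v,
      is_dx 1 v w, contin L2 L2norm 1 w, contin L2 L2norm 1 g &
      forall psi, H10 psi -> forall x, 0 < x < 1 ->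
        is_derive x 1 (fun x => L2ip (w x) psi)
          (- L2ip (wderiv (v x)) (wderiv psi) + L2ip (g x) psi)].

(** For fixed psi, [z x psi] equals almost everywhere the function e below, which is continuous in x
    because v_y and g are continuous into L^2. The weak derivative of <w, psi> is thus continuous,
    hence classical. *)
Lemma weak_solution_evolution (u0 : R -> R) g v : weak_solution u0 g v ->
  contin L2 L2norm 1 g ->
  exists w, [/\ evolution v w g, v 0 = u0 %[ae mu01] & w 0 = (fun=> 0) %[ae mu01]].
Proof.
move=> [w [z [/contin_eps[v1 v2] [dvw cw] [[zH zm _] dwz] eqn [v0 w0]]]] cg.
exists w; split => //.
have cv : contin H1 H1norm 1 v.
  by apply/contin_eps; split => // x xI; exact/H10_H1/v1.
split => // psi Hpsi.
have Lp := H1_L2 (H10_H1 Hpsi); have Lp' := wderiv_L2 (H10_H1 Hpsi).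
pose e x := - L2ip (wderiv (v x)) (wderiv psi) + L2ip (g x) psi.
have ce : {within `[(0 : R), 1], continuous e}.
  have /subspace_continuousP c1 := contin_L2ip (H1_contin_wderiv cv) Lp'.
  have /subspace_continuousP c2 := contin_L2ip cg Lp.
  apply/subspace_continuousP => x xI; apply: cvgD; [apply: cvgN; exact: c1|exact: c2].
have cf := contin_L2ip cw Lp.
apply: (weak_derivative_is_derive cf ce) => th tth.
rewrite (dwz _ _ tth Hpsi); congr (- _).
have [_ [a [b [a0 b1 th0]]]] := tth.
(* The integrals are restricted to ]0, 1[ because [z x psi] is known to be measurable only there. *)
have supp (h : R -> R) : (\int[mu01]_x (h x * th x)%:E = \int[mu01]_(x in `]0%R, 1%R[) (h x * th x)%:E)%E.
  rewrite [RHS]integral_mkcond; apply: eq_integral => x _; rewrite patchE.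
  case: ifPn => //; rewrite mem_setE in_itv/= => nx.
  rewrite th0 ?mulr0//; apply: contra nx; rewrite in_itv/= => /andP[ax xb].
  by rewrite (lt_le_trans a0) ?(le_lt_trans xb).
rewrite /Rintegral; congr fine; rewrite !supp; apply: ae_eq_integral => //.
- apply/measurable_EFinP; apply: measurable_funM; first exact: zm.
  by apply: measurable_funTS; apply: continuous_measurable_fun; exact: test_fun_continuous.
- apply/measurable_EFinP; apply: measurable_funM.
    have ce' : {within `](0 : R), 1[, continuous e}.
      by apply: continuous_subspaceW ce; exact: subset_itv_oo_cc.
    exact: (subspace_continuous_measurable_fun (measurable_itv _) ce').
  by apply: measurable_funTS; apply: continuous_measurable_fun; exact: test_fun_continuous.
- apply: filterS (eqn _ Hpsi) => x H _; congr (_ * _)%:E.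
  by rewrite /e -H addrC addrK.
Qed.

Lemma evolution_subr v1 w1 g1 v2 w2 g2 : evolution v1 w1 g1 -> evolution v2 w2 g2 ->
  evolution (fun x y => v1 x y - v2 x y) (fun x y => w1 x y - w2 x y)
    (fun x y => g1 x y - g2 x y).
Proof.
move=> [[v11 v12] dv1 cw1 cg1 ev1] [[v21 v22] dv2 cw2 cg2 ev2]; split.
- split; last exact: H1_contin_subr.
  by move=> x xI; apply: H10_subr; [exact: v11|exact: v21].
- exact: is_dx_subr.
- exact: L2_contin_subr.
- exact: L2_contin_subr.
- move=> psi Hpsi x x01; have Hp := H10_H1 Hpsi.
  have W (y : R) : 0 < y < 1 -> 0 <= y <= 1 by move=> /andP[/ltW -> /ltW ->].
  have Lw1 y : 0 < y < 1 -> L2 (w1 y) by move=> /W yI; case/contin_eps: cw1 => H _; exact: H.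
  have Lw2 y : 0 < y < 1 -> L2 (w2 y) by move=> /W yI; case/contin_eps: cw2 => H _; exact: H.
  have Lg1 : L2 (g1 x) by case/contin_eps: cg1 => H _; exact/H/W.
  have Lg2 : L2 (g2 x) by case/contin_eps: cg2 => H _; exact/H/W.
  have H1v := H10_H1 (v11 _ (W _ x01)); have H2v := H10_H1 (v21 _ (W _ x01)).
  have D := is_deriveB (ev1 _ Hpsi _ x01) (ev2 _ Hpsi _ x01).
  case/andP: (x01) => x0 x1.
  have := near_is_derive x0 x1 _ D.
  move=> /(_ (fun x => L2ip (fun y => w1 x y - w2 x y) psi)) D'.
  apply: is_derive_eq (D' _) _.
    move=> y y0 y1; rewrite (semi_innerBl semi_inner_L2)//; last exact: H1_L2.
    + by apply: Lw1; rewrite y0.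
    + by apply: Lw2; rewrite y0.
  have Lp' := wderiv_L2 Hp.
  rewrite (L2ip_ae _ _ Lp' (wderivB H1v H2v)); last 2 first.
  + exact/wderiv_L2/H1_subr.
  + by apply: L2_subr; exact: wderiv_L2.
  rewrite (semi_innerBl semi_inner_L2 (wderiv_L2 H1v) (wderiv_L2 H2v) Lp').
  rewrite (semi_innerBl semi_inner_L2 Lg1 Lg2 (H1_L2 Hp)).
  move: (L2ip (wderiv (v1 x)) _) (L2ip (wderiv (v2 x)) _) (L2ip (g1 x) _) (L2ip (g2 x) _).
  by move=> p q r s; ring.
Qed.

Lemma cont2_sub (D D' : set R) (F : R -> R -> R) : D `<=` D' -> cont2 D' F -> cont2 D F.
Proof.
move=> DD H x y /DD Dx /DD Dy e e0; have [d d0 Hd] := H x y Dx Dy e e0.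
by exists d => // x' y' /DD Dx' /DD Dy'; exact: Hd.
Qed.

Lemma interior_approx T x (d : R) : 0 < T -> 0 <= x <= T -> 0 < d ->
  exists2 x', 0 < x' < T & `|x' - x| < d.
Proof.
move=> T0 /andP[x0 xT] d0.
pose m := Num.min d T.
have m0 : 0 < m by rewrite lt_min d0.
have [md mT] : m <= d /\ m <= T by rewrite /m !ge_min !lexx orbT.
clearbody m; have [h|h] := leP x (T / 2).
  exists (x + m / 3); first by apply/andP; split; lra.
  by rewrite ltr_norml; apply/andP; split; lra.
exists (x - m / 3); first by apply/andP; split; lra.
by rewrite ltr_norml; apply/andP; split; lra.
Qed.

(** The energy balance compares interior points only; continuity lets a tend to 0 and b tend to
    x. *)
Lemma le_from_interior (F : R -> R) (C T : R) : 0 < T -> 0 <= C ->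
  {within `[(0 : R), T], continuous F} -> F 0 = 0 ->
  (forall a b, 0 < a -> a <= b -> b < T -> F b - F a <= (b - a) * C) ->
  forall x, 0 <= x <= T -> F x <= T * C.
Proof.
move=> T0 C0 /subspace_continuousP cF F0 FC x xI.
have c0 : F s @[s --> within `[(0 : R), T] (nbhs (0 : R))] --> F 0.
  by apply: cF; rewrite /= in_itv/= lexx ltW.
have cx : F s @[s --> within `[(0 : R), T] (nbhs x)] --> F x.
  by apply: cF; rewrite /= in_itv.
apply/ler_addgt0Pr => e e0; have e2 : 0 < e / 2 by rewrite divr_gt0.
have [d1 d10 D1] := (cvg_within_eps _ _ _ _).1 c0 _ e2.
have [d2 d20 D2] := (cvg_within_eps _ _ _ _).1 cx _ e2.
have [b /andP[b0 bT] bx] := interior_approx T0 xI d20.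
pose a := Num.min d1 b / 2.
have m0 : 0 < Num.min d1 b by rewrite lt_min d10.
have [md mb] : Num.min d1 b <= d1 /\ Num.min d1 b <= b by rewrite !ge_min !lexx orbT.
have a0 : 0 < a by rewrite divr_gt0.
have ab : a <= b by rewrite /a; clear -m0 mb; lra.
have ad : a < d1 by rewrite /a; clear -m0 md; lra.
have Fa : `|F a - F 0| <= e / 2.
  apply: D1; first by rewrite /= in_itv/= (ltW a0) (le_trans ab (ltW bT)).
  by rewrite subr0 gtr0_norm.
have Fb : `|F b - F x| <= e / 2 by apply: D2 => //; rewrite /= in_itv/= !ltW.
have := FC _ _ a0 ab bT; move: Fa Fb; rewrite F0 subr0 !ler_norml => /andP[_ Fa] /andP[Fb _] Fba.
have : (b - a) * C <= T * C by rewrite ler_wpM2r//; clear -a0 bT; lra.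
move: ((b - a) * C) (T * C) Fba => p q; clear -Fa Fb; lra.
Qed.

(** With S the maximum of ||w||, the balance gives E <= 2 T Gs S. Evaluation where the maximum is
    attained yields S <= 2 T Gs, which then bounds v_y through E and v through the mean value
    theorem. *)
Lemma evolution_estimate v w g T Gs : evolution v w g -> 0 < T -> T <= 1 ->
  H1norm (v 0) = 0 -> L2norm (w 0) = 0 ->
  (forall x, 0 <= x <= T -> L2norm (g x) <= Gs) ->
  forall x, 0 <= x <= T -> H1norm (v x) <= 3 * T * Gs /\ L2norm (w x) <= 2 * T * Gs.
Proof.
move=> [[vH cv] dv cw cg ev] T0 T1 v0 w0 gG.
have Gs0 : 0 <= Gs.
  by apply: le_trans (gG 0 _); rewrite ?L2norm_ge0// lexx ltW.
have cwT := contin_restrict T1 cw; have cvT := contin_restrict T1 cv.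
have cvy := H1_contin_wderiv cv; have cvyT := H1_contin_wderiv cvT.
have W x : 0 <= x <= T -> 0 <= x <= 1 by move=> /andP[-> /le_trans]; exact.
have W' x : 0 < x < T -> 0 < x < 1 by move=> /andP[-> /lt_le_trans]; exact.
have W'' x : 0 < x < T -> 0 <= x <= T by move=> /andP[/ltW -> /ltW ->].
have Lw x : 0 <= x <= T -> L2 (w x) by move=> /W xI; case/contin_eps: cw => H _; exact: H.
have Lg x : 0 <= x <= T -> L2 (g x) by move=> /W xI; case/contin_eps: cg => H _; exact: H.
have Hv x : 0 <= x <= T -> H1 (v x) by move=> /W xI; exact/H10_H1/vH.
have cnw := contin_norm semi_inner_L2 L2normE cwT.
have cnvy := contin_norm semi_inner_L2 L2normE cvyT.
have [c] := EVT_max (ltW T0) cnw; rewrite in_itv/= => cI; set S := L2norm (w c) => Smax.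
have {}Smax x : 0 <= x <= T -> L2norm (w x) <= S by move=> xI; apply: Smax; rewrite in_itv.
have S0 : 0 <= S by exact: L2norm_ge0.
pose E x := L2ip (w x) (w x) + L2ip (wderiv (v x)) (wderiv (v x)).
have Ebal a b : 0 < a -> a <= b -> b < T -> E b - E a <= 2 * (b - a) * (Gs * S).
  have DD : [set x : R | 0 < x < T] `<=` [set x : R | 0 < x < 1] by move=> x /W'.
  pose phi r s := L2ip (w r) (v s); pose m r s := L2ip (w r) (w s).
  pose n r s := L2ip (wderiv (v r)) (wderiv (v s)).
  pose G r s := L2ip (g r) (v s); pose k r s := L2ip (g r) (w s).
  have d1 r s : 0 < r < T -> 0 < s < T -> is_derive s 1 (phi r) (m r s).
    move=> /W'' rI /W' sI.
    rewrite (_ : phi r = fun s => L2ip (v s) (w r)); last by apply/funext => t; exact: L2ipC.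
    by rewrite /m L2ipC; exact: (is_dx_is_derive dv (Lw _ rI) sI).
  (* The equation at r is tested with [v s], which lies in H_0^1, whereas [w s] is only known to lie
     in L^2. *)
  have d2 r s : 0 < r < T -> 0 < s < T -> is_derive r 1 (phi^~ s) (- n r s + G r s).
    by move=> /W' rI /W'' /W sI; exact: (ev _ (vH _ sI) _ rI).
  have d3 r s : 0 < r < T -> 0 < s < T -> is_derive s 1 (G r) (k r s).
    move=> /W'' rI /W' sI.
    rewrite (_ : G r = fun s => L2ip (v s) (g r)); last by apply/funext => t; exact: L2ipC.
    by rewrite /k L2ipC; exact: (is_dx_is_derive dv (Lg _ rI) sI).
  have kK r s : 0 < r < T -> 0 < s < T -> `|k r s| <= Gs * S.
    move=> /W'' rI /W'' sI; rewrite (le_trans (L2ip_CS (Lg _ rI) (Lw _ sI)))//.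
    by rewrite ler_pM ?L2norm_ge0 ?gG ?Smax.
  have cm : cont2 [set x : R | 0 < x < T] m := cont2_sub DD (cont2_L2ip cw cw).
  have cn : cont2 [set x : R | 0 < x < T] n := cont2_sub DD (cont2_L2ip cvy cvy).
  have cG : cont2 [set x : R | 0 < x < T] G := cont2_sub DD (cont2_L2ip cg (H1_contin_L2 cv)).
  have sm r s : m r s = m s r by exact: L2ipC.
  have sn r s : n r s = n s r by exact: L2ipC.
  have B := energy_balance d1 d2 d3 kK cm cn cG sm sn.
  by move=> a0 ab bT; exact: (B _ _ a0 ab bT).
have EE x : E x = L2norm (w x) ^+ 2 + L2norm (wderiv (v x)) ^+ 2 by rewrite !L2norm_sqr.
have cE : {within `[(0 : R), T], continuous E}.
  rewrite (_ : E = fun x => L2norm (w x) ^+ 2 + L2norm (wderiv (v x)) ^+ 2); last exact/funext.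
  move/subspace_continuousP: cnw => cnw; move/subspace_continuousP: cnvy => cnvy.
  apply/subspace_continuousP => x xI; apply: cvgD; rewrite /from_subspace.
    by under eq_fun do rewrite expr2; apply: cvgM; exact: cnw.
  by under eq_fun do rewrite expr2; apply: cvgM; exact: cnvy.
have E0 : E 0 = 0.
  rewrite EE w0; have := L2norm_wderiv_le_H1norm (v 0); rewrite v0 => vy0.
  have -> : L2norm (wderiv (v 0)) = 0 by apply/eqP; rewrite eq_le vy0 L2norm_ge0.
  by rewrite expr0n addr0.
have ET x : 0 <= x <= T -> E x <= T * (2 * (Gs * S)).
  apply: (le_from_interior T0 _ cE E0); first by rewrite !mulr_ge0.
  move=> a b a0 ab bT; rewrite (_ : (b - a) * _ = 2 * (b - a) * (Gs * S)); last by ring.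
  exact: Ebal.
(* At the maximum point c, S^2 <= E c <= 2 T Gs S; one factor S is divided out. *)
have S2 : S <= 2 * T * Gs.
  have [->|Sn0] := eqVneq S 0; first by rewrite !mulr_ge0// ltW.
  have Sp : 0 < S by rewrite lt_neqAle eq_sym Sn0.
  rewrite -(ler_pM2r Sp); have := ET _ cI; rewrite EE -/S => H.
  rewrite (_ : 2 * T * Gs * S = T * (2 * (Gs * S))); last by ring.
  by apply: le_trans H; rewrite -expr2 lerDl sqr_ge0.
have TG0 : 0 <= 2 * T * Gs by rewrite !mulr_ge0// ltW.
move=> x xI; split; last exact: le_trans (Smax _ xI) S2.
have Hx := Hv _ xI; have Lx := H1_L2 Hx.
have B1 : L2norm (wderiv (v x)) ^+ 2 <= (2 * T * Gs) ^+ 2.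
  apply: (le_trans (y := E x)); first by rewrite EE lerDr sqr_ge0.
  apply: (le_trans (ET _ xI)).
  rewrite (_ : T * (2 * (Gs * S)) = 2 * T * Gs * S); last by ring.
  by rewrite expr2 ler_wpM2l.
(* Pairing the curve with its own value v(x) reduces the bound to a real mean value theorem:
   ||v(x)||^2 = x <w(r), v(x)> for some r, and x <= 1. *)
have B2 : L2norm (v x) <= 2 * T * Gs.
  have [->|n0] := eqVneq (L2norm (v x)) 0; first by [].
  have np : 0 < L2norm (v x) by rewrite lt_neqAle eq_sym n0 L2norm_ge0.
  case/andP: (xI) => x0 xT.
  pose F s := L2ip (v s) (v x); pose dF s := L2ip (w s) (v x).
  have dFF s : s \in `]0, x[ -> is_derive s 1 F (dF s).
    rewrite in_itv/= => /andP[s0 sx]; apply: (is_dx_is_derive dv Lx).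
    by rewrite s0 (lt_le_trans sx)// (le_trans xT).
  have cF : {within `[(0 : R), x], continuous F}.
    apply: continuous_subspaceW (contin_L2ip (H1_contin_L2 cv) Lx).
    by move=> s /=; rewrite !in_itv/= => /andP[-> /le_trans]; apply; exact: le_trans T1.
  have [r] := MVT_segment x0 dFF cF.
  rewrite in_itv/= => /andP[r0 rx].
  have rI : 0 <= r <= T by rewrite r0 (le_trans rx).
  have L0 : L2 (v 0) by apply/H1_L2/Hv; rewrite lexx ltW.
  have F0 : F 0 = 0.
    apply/eqP; rewrite -normr_eq0 eq_le normr_ge0 andbT.
    rewrite (le_trans (L2ip_CS L0 Lx))//.
    have := L2norm_le_H1norm (v 0); rewrite v0 => v00.
    by rewrite (_ : L2norm (v 0) = 0) ?mul0r//; apply/eqP; rewrite eq_le v00 L2norm_ge0.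
  rewrite F0 !subr0 {1}/F -L2norm_sqr /dF => nE.
  rewrite -(ler_pM2r np) -expr2 nE.
  apply: (le_trans (ler_wpM2r x0 (ler_norm _))).
  apply: (le_trans (y := `|L2ip (w r) (v x)|)); first by rewrite ler_piMr// (le_trans xT).
  rewrite (le_trans (L2ip_CS (Lw _ rI) Lx))// ler_wpM2r ?L2norm_ge0//.
  exact: le_trans (Smax _ rI) S2.
rewrite -(@ler_pXn2r _ 2) ?nnegrE ?H1norm_ge0//; last by rewrite !mulr_ge0// ltW.
rewrite H1norm_sqr.
have B2' : L2norm (v x) ^+ 2 <= (2 * T * Gs) ^+ 2 by rewrite ler_pXn2r ?nnegrE ?L2norm_ge0.
apply: (le_trans (lerD B2' B1)).
(* The constant 3 comes from 2^2 + 2^2 <= 3^2. *)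
rewrite (_ : (3 * T * Gs) ^+ 2 = (2 * T * Gs) ^+ 2 + (2 * T * Gs) ^+ 2 + (T * Gs) ^+ 2); last by ring.
by rewrite lerDl sqr_ge0.
Qed.

End Evolution.

(** * Contraction of the solution map *)

Section Contraction.
Context {R : realType}.
Implicit Types (f psi : R -> R) (x T : R) (a u v w : R -> R -> R).
Notation mu01 := (@mu01 R).

Lemma HH_restrict T T' u : T' <= T -> HH T u -> HH T' u.
Proof.
move=> TT [cu [w duw cw]]; split; first exact: contin_restrict cu.
by exists w; [exact: is_dx_restrict duw|exact: contin_restrict cw].
Qed.

Lemma HH_subr T u v : HH T u -> HH T v -> HH T (fun x y => u x y - v x y).
Proof.
move=> [cu [w duw cw]] [cv [z dvz cz]]; split; first exact: H1_contin_subr.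
by exists (fun x y => w x y - z x y); [exact: is_dx_subr|exact: L2_contin_subr].
Qed.

Lemma HH0 T : HH T (fun _ _ => 0 : R).
Proof.
have H10 : H1norm (fun=> 0 : R) = 0 by rewrite H1normE (semi_norm0 semi_inner_H1).
have L20 : L2norm (fun=> 0 : R) = 0 by rewrite L2normE (semi_norm0 semi_inner_L2).
split; last exists (fun _ _ => 0).
- apply/contin_eps; split=> x _; first by case: (@semi_inner_H1 R).
  move=> e e0; exists 1 => // s _ _.
  by rewrite (_ : (fun _ => _) = fun=> 0) ?H10 ?normr0 ?ltW//; apply/funext => y; rewrite subrr.
- apply/is_dx_eps; split=> x _; first by split; exact: L2_0.
  move=> e e0; exists 1 => // s _ _ _.
  by rewrite (_ : (fun _ => _) = fun=> 0) ?L20 ?ltW//; apply/funext => y; rewrite subrr mul0r subrr.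
- apply/contin_eps; split=> x _; first exact: L2_0.
  move=> e e0; exists 1 => // s _ _.
  by rewrite (_ : (fun _ => _) = fun=> 0) ?L20 ?normr0 ?ltW//; apply/funext => y; rewrite subrr.
Qed.

(** Gives access to [HHnorm] through any derivative w in place of the chosen [dx]. S1 and S2 are the
    two suprema, finite by continuity on [0, T]; the last clause expresses that they are least upper
    bounds. *)
Lemma HHnormP T u w : 0 < T -> contin H1 H1norm T u -> is_dx T u w ->
  contin L2 L2norm T w -> exists S1 S2, [/\ HHnorm T u = S1 + S2,
    (forall x, 0 <= x <= T -> H1norm (u x) <= S1),
    (forall x, 0 <= x <= T -> L2norm (w x) <= S2) &
    (forall A B, (forall x, 0 <= x <= T -> H1norm (u x) <= A) ->
       (forall x, 0 <= x <= T -> L2norm (w x) <= B) -> S1 + S2 <= A + B)].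
Proof.
move=> T0 cu duw cw.
have ddx : is_dx T u (dx T u).
  by apply: (@xgetPex _ (fun _ _ => 0) [set u' | is_dx T u u']); exists w.
have dxE x : 0 <= x <= T -> L2norm (dx T u x) = L2norm (w x) by exact: is_dx_unique ddx duw.
have I0 : 0 <= (0 : R) <= T by rewrite lexx ltW.
have [M1 HM1] := contin_norm_bounded semi_inner_H1 H1normE cu.
have [M2 HM2] := contin_norm_bounded semi_inner_L2 L2normE cw.
exists (sup [set H1norm (u x) | x in `[0, T]]), (sup [set L2norm (dx T u x) | x in `[0, T]]).
split => //.
- move=> x xI; apply: ub_le_sup; last by exists x; rewrite //= in_itv.
  by exists M1 => ? [y /=]; rewrite in_itv/= => yI <-; exact: HM1.
- move=> x xI; rewrite -dxE//; apply: ub_le_sup; last by exists x; rewrite //= in_itv.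
  by exists M2 => ? [y /=]; rewrite in_itv/= => yI <-; rewrite dxE//; exact: HM2.
- move=> A B HA HB; apply: lerD; apply: ge_sup.
  + by exists (H1norm (u 0)), 0; rewrite //= in_itv.
  + by move=> ? [y /=]; rewrite in_itv/= => yI <-; exact: HA.
  + by exists (L2norm (dx T u 0)), 0; rewrite //= in_itv.
  + by move=> ? [y /=]; rewrite in_itv/= => yI <-; rewrite dxE//; exact: HB.
Qed.

Lemma H1norm_le_HHnorm T u x : 0 < T -> HH T u -> 0 <= x <= T ->
  H1norm (u x) <= HHnorm T u.
Proof.
move=> T0 [cu [w duw cw]] xI; have [S1 [S2 [-> HS1 HS2 _]]] := HHnormP T0 cu duw cw.
by rewrite (le_trans (HS1 _ xI))// lerDl (le_trans _ (HS2 _ xI))// L2norm_ge0.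
Qed.

Lemma HHnorm_ge0 T u : 0 < T -> HH T u -> 0 <= HHnorm T u.
Proof.
move=> T0 Hu; apply: le_trans (H1norm_le_HHnorm T0 Hu (x := 0) _); first exact: H1norm_ge0.
by rewrite lexx ltW.
Qed.

Lemma H1norm_subr f psi : H1 f -> H1 psi ->
  H1norm (fun y => f y - psi y) <= H1norm f + H1norm psi.
Proof. by rewrite !H1normE; exact: (semi_normB semi_inner_H1). Qed.

Lemma L2norm_subr f psi : L2 f -> L2 psi ->
  L2norm (fun y => f y - psi y) <= L2norm f + L2norm psi.
Proof. by rewrite !L2normE; exact: (semi_normB semi_inner_L2). Qed.

Lemma HHnorm_subr T u v : 0 < T -> HH T u -> HH T v ->
  HHnorm T (fun x y => u x y - v x y) <= HHnorm T u + HHnorm T v.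
Proof.
move=> T0 [cu [w duw cw]] [cv [z dvz cz]].
have [U1 [U2 [-> uU wU _]]] := HHnormP T0 cu duw cw.
have [V1 [V2 [-> vV zV _]]] := HHnormP T0 cv dvz cz.
have [S1 [S2 [-> _ _ S12]]] := HHnormP T0 (H1_contin_subr cu cv) (is_dx_subr duw dvz) (L2_contin_subr cw cz).
rewrite addrACA; apply: S12 => x xI.
- have [[Hu _] [Hv _]] := (proj1 (contin_eps _ _ _ _) cu, proj1 (contin_eps _ _ _ _) cv).
  exact: le_trans (H1norm_subr (Hu _ xI) (Hv _ xI)) (lerD (uU _ xI) (vV _ xI)).
- have [[Lw _] [Lz _]] := (proj1 (contin_eps _ _ _ _) cw, proj1 (contin_eps _ _ _ _) cz).
  exact: le_trans (L2norm_subr (Lw _ xI) (Lz _ xI)) (lerD (wU _ xI) (zV _ xI)).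
Qed.

Lemma weak_solution_HH (u0 : R -> R) (g v : R -> R -> R) : weak_solution u0 g v -> HH 1 v.
Proof.
move=> [w [z [/contin_eps[v1 v2] [dvw cw] _ _ _]]]; split; last by exists w.
by apply/contin_eps; split => // x xI; exact/H10_H1/v1.
Qed.

Section Source.
Context (C1 c : R) (P : (R -> R) -> R -> R) (HP : stabilized C1 c P).

Lemma stabilized_subr f g : H1 f -> H1 g ->
  L2norm (fun y => P f y - P g y) <= C1 * ln c * H1norm (fun y => f y - g y).
Proof.
case: HP => PL Plin Pb Hf Hg; have HB := H1_subr Hf Hg.
rewrite -(L2norm_ae (PL _ HB)); first exact: Pb.
- exact: L2_subr (PL _ Hf) (PL _ Hg).
- rewrite (_ : (fun y => f y - g y) = fun y => -1 * g y + f y).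
    by apply: filterS (Plin (-1) _ _ Hg Hf) => y /[apply] ->; rewrite mulN1r addrC.
  by apply/funext => y; ring.
Qed.

Lemma stabilized_source_subr f g : H1 f -> H1 g ->
  L2norm (fun y => - P f y - - P g y) <= C1 * ln c * H1norm (fun y => f y - g y).
Proof.
move=> Hf Hg; rewrite [X in _ * X](_ : _ = H1norm (fun y => g y - f y)).
  rewrite (_ : (fun _ => _) = fun y => P g y - P f y); first exact: stabilized_subr.
  by apply/funext => y; ring.
by rewrite !H1normE; exact: (semi_norm_distC semi_inner_H1 Hf Hg).
Qed.

Lemma stabilized_source_contin a : 0 <= C1 * ln c -> contin H1 H1norm 1 a ->
  contin L2 L2norm 1 (fun x y => - P (a x) y).
Proof.
move=> L0 /contin_eps[a1 a2]; apply/contin_eps; split=> x xI.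
  rewrite (_ : (fun _ => _) = fun y => -1 * P (a x) y + 0); last first.
    by apply/funext => y; ring.
  by apply: L2_lin L2_0; case: HP => PL _ _; exact/PL/a1.
(* The + 1 keeps the divisor positive when [ln c = 0]. *)
move=> e e0; have L10 : 0 < C1 * ln c + 1 by rewrite ltr_wpDl.
have [|d d0 Hd] := a2 _ xI (e / (C1 * ln c + 1)); first by rewrite divr_gt0.
exists d => // s sI sx; have := Hd _ sI sx.
rewrite !ger0_norm ?L2norm_ge0 ?H1norm_ge0// ler_pdivlMr// => He.
rewrite (le_trans (stabilized_source_subr (a1 _ sI) (a1 _ xI)))// mulrC.
by apply: le_trans He; rewrite ler_wpM2l ?H1norm_ge0// lerDl.
Qed.

(** Nothing separates a2 from v2, so a2 = v2 is allowed: the regularized solution enters as a fixed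
    point in this way. The data u0 cancel in the difference, which therefore has zero Cauchy
    data. *)
Lemma source_contraction (T : R) (u0 : R -> R) a1 a2 v1 v2 :
  0 <= C1 * ln c -> 0 < T -> T <= 1 -> 10 * T * (C1 * ln c) <= 1 ->
  HH 1 a1 -> HH 1 a2 ->
  weak_solution u0 (fun x y => - P (a1 x) y) v1 ->
  weak_solution u0 (fun x y => - P (a2 x) y) v2 ->
  HHnorm T (fun x y => v1 x y - v2 x y) <= 1 / 2 * HHnorm T (fun x y => a1 x y - a2 x y).
Proof.
move=> L0 T0 T1 TL Ha1 Ha2 W1 W2.
have [ca1 _] := Ha1; have [ca2 _] := Ha2.
have [w1 [E1 i1 j1]] := weak_solution_evolution W1 (stabilized_source_contin L0 ca1).
have [w2 [E2 i2 j2]] := weak_solution_evolution W2 (stabilized_source_contin L0 ca2).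
have E := evolution_subr E1 E2.
have I0 : 0 <= (0 : R) <= 1 by rewrite lexx ler01.
have [[vH cv] dv cw cg _] := E.
have v0 : H1norm (fun y => v1 0 y - v2 0 y) = 0.
  apply: H1norm_ae0; first exact: H10_H1 (vH _ I0).
  by apply: filterS2 i1 i2 => y H1 H2 yT; rewrite (H1 yT) (H2 yT) subrr.
have w0 : L2norm (fun y => w1 0 y - w2 0 y) = 0.
  have Lw : L2 (fun y => w1 0 y - w2 0 y) by case/contin_eps: cw => H _; exact: (H 0).
  rewrite (L2norm_ae Lw L2_0); first by rewrite L2normE (semi_norm0 semi_inner_L2).
  by apply: filterS2 j1 j2 => y H1 H2 yT; rewrite (H1 yT) (H2 yT) subrr.
set M := HHnorm T (fun x y => a1 x y - a2 x y).
have HA : HH T (fun x y => a1 x y - a2 x y) by apply/(HH_restrict T1)/HH_subr.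
have gM x : 0 <= x <= T -> L2norm (fun y => - P (a1 x) y - - P (a2 x) y) <= C1 * ln c * M.
  move=> xI; have xI1 : 0 <= x <= 1 by case/andP: xI => -> /le_trans; exact.
  have [[H1a _] [H2a _]] := (proj1 (contin_eps _ _ _ _) ca1, proj1 (contin_eps _ _ _ _) ca2).
  rewrite (le_trans (stabilized_source_subr (H1a _ xI1) (H2a _ xI1)))// ler_wpM2l//.
  exact: (H1norm_le_HHnorm T0 HA xI).
have est := evolution_estimate E T0 T1 v0 w0 gM.
have [S1 [S2 [-> _ _ S12]]] := HHnormP T0 (contin_restrict T1 cv) (is_dx_restrict T1 dv) (contin_restrict T1 cw).
(* The term with 3 bounds the H^1 part of the norm, the term with 2 the part of the x-derivative. *)
apply: (le_trans (y := 3 * T * (C1 * ln c * M) + 2 * T * (C1 * ln c * M))).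
  by apply: S12 => x /est[].
have M0 : 0 <= M by exact: HHnorm_ge0.
rewrite (_ : _ + _ = 1 / 2 * ((10 * T * (C1 * ln c)) * M)); last by field.
by rewrite ler_wpM2l// ler_piMl.
Qed.

End Source.
End Contraction.

(** * Choice of the interval and convergence of the iterates *)

Unset Implicit Arguments.

(** Given C1, [xbar] depends only on the value c of gamma(beta), and [eta] is chosen before the
    operators, the data and the iterates, so both are uniform in them. *)
Theorem theorem5p1 (R : realType) (C1 : R) (C1_gt0 : 0 < C1) :
  exists xbar : R -> R,
  (forall c : R, 1 <= c -> 0 < xbar c <= 1) /\
  forall gamma : R -> R,
    (forall b : R, 0 < b < 1 -> 1 <= gamma b) ->
    gamma b @[b --> 0^'+] --> +oo ->
  exists eta : R -> R,
  (forall b : R, 0 < b < 1 -> 0 < eta b < 1) /\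
  forall (beta : R -> R) (P : R -> (R -> R) -> R -> R)
         (u0 : R -> R) (u0eps : R -> R -> R),
    (forall eps : R, 0 < eps < 1 -> 0 < beta eps < 1) ->
    beta eps @[eps --> 0^'+] --> 0 ->
    (forall eps : R, 0 < eps < 1 ->
       stabilized C1 (gamma (beta eps)) (P eps)) ->
    H1 u0 ->
    (forall eps : R, 0 < eps < 1 ->
       H1 (u0eps eps) /\ H1norm (fun y => u0eps eps y - u0 y) <= eps) ->
  forall eps : R, 0 < eps < 1 ->
  forall (u : nat -> R -> R -> R) (ureg : R -> R -> R),
    u 0%N = (fun _ _ => 0) ->
    (forall k : nat,
       the_weak_solution (u0eps eps)
         (fun _ x y => - P eps (u k x) y) (u k.+1)) ->
    the_weak_solution (u0eps eps)
      (fun v x y => - P eps (v x) y) ureg ->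
  let T := xbar (gamma (beta eps)) in
  let q := eta (beta eps) in
  strongly_convergent_HH T u /\
  forall k : nat,
    HHnorm T (fun x y => u k x y - ureg x y)
      <= q ^+ k / (1 - q) * HHnorm T (u 1%N).
Proof.
have L0 c : 1 <= c -> 0 <= C1 * ln c by move=> c1; rewrite mulr_ge0 ?ln_ge0// ltW.
exists (fun c => (10 * (C1 * ln c) + 1)^-1); split.
  move=> c /L0 Lc; have p : 0 < 10 * (C1 * ln c) + 1 by rewrite ltr_wpDl// mulr_ge0.
  by rewrite invr_gt0 p invf_le1// lerDr mulr_ge0.
move=> gamma gamma1 _; exists (fun=> 1 / 2); split; first by move=> b _; apply/andP; split; lra.
move=> beta P u0 u0eps beta01 _ stab _ _ eps eps01 u ureg u00 uS [Wreg _] T q.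
have HP := stab _ eps01; pose c := gamma (beta eps).
have Lc : 0 <= C1 * ln c by apply/L0/gamma1/beta01.
have p : 0 < 10 * (C1 * ln c) + 1 by rewrite ltr_wpDl// mulr_ge0.
have T0 : 0 < T by rewrite /T invr_gt0.
have T1 : T <= 1 by rewrite /T invf_le1// lerDr mulr_ge0.
have TL : 10 * T * (C1 * ln c) <= 1.
  by rewrite mulrAC /T ler_pdivrMr// mul1r lerDl.
have Hu k : HH 1 (u k).
  by case: k => [|k]; [rewrite u00; exact: HH0|exact: weak_solution_HH (uS k).1].
have Hreg : HH 1 ureg := weak_solution_HH Wreg.
have HuT k := HH_restrict T1 (Hu k); have HregT := HH_restrict T1 Hreg.
pose N k := HHnorm T (fun x y => u k x y - ureg x y).
have HN k : HH T (fun x y => u k x y - ureg x y) by apply: HH_subr.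
(* [ureg] is both the second source and the second solution, being a fixed point of the solution
   map. *)
have NS k : N k.+1 <= 1 / 2 * N k.
  exact: (source_contraction HP Lc T0 T1 TL (Hu k) Hreg (uS k).1 Wreg).
have Nk k : N k <= q ^+ k * N 0%N.
  elim: k => [|k IH]; first by rewrite expr0 mul1r.
  apply: (le_trans (NS k)); rewrite exprS -[leRHS]mulrA.
  by apply: ler_wpM2l IH; rewrite divr_ge0.
(* As the zeroth iterate is 0, the triangle inequality gives N 0 <= N 1 + ||u 1|| <= N 0 / 2 + ||u
   1||. The resulting factor 2 is exactly 1 / (1 - q). *)
have N0 : N 0%N <= 2 * HHnorm T (u 1%N).
  have : N 0%N <= N 1%N + HHnorm T (u 1%N).
    rewrite {1}/N (_ : (fun _ _ => _) = fun x y => (u 1%N x y - ureg x y) - u 1%N x y).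
      exact: HHnorm_subr.
    by apply/funext => x; apply/funext => y; rewrite u00; ring.
  by have := NS 0%N; lra.
split.
- split; first exact: HuT.
  exists ureg => //; apply: (@squeeze_cvgr _ _ _ _ (cst 0) (fun k => q ^+ k * N 0%N)).
  + by apply: nearW => k; rewrite HHnorm_ge0// Nk.
  + exact: cvg_cst.
  + rewrite -[X in _ --> X](mul0r (N 0%N)); apply: cvgMl.
    by apply: cvg_expr; rewrite ger0_norm /q; lra.
- move=> k; rewrite (le_trans (Nk k))// -mulrA ler_wpM2l ?exprn_ge0 ?divr_ge0//.
  apply: (le_trans N0); rewrite ler_wpM2r ?HHnorm_ge0//.
  by rewrite /q (_ : (1 - 1 / 2)^-1 = 2)//; field.
Qed.
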